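(* For every even integer $k \ge 4$, $$\min_{a} v_2\left(w(a,k)\right) = \begin{cases} 0 & \text{if } k \text{ is a power of } 2,\\ s(k)-2 & \text{if } k \text{ is not a power of } 2,\end{cases}$$ where the minimum is taken over all integers $a\ge 0$ for which there is an integer $b\ge 0$ with $4a+6b=k$.
   Context: For even $k\ge 4$ and $z$ in the complex upper half-plane, let $E_k(z)=\frac12\sum_{(a,b)=1}\frac{1}{(az+b)^k}$ (sum over pairs of coprime integers $a,b$) and $G_k=2\zeta(k)E_k$, where $\zeta$ is the Riemann zeta function. The coefficients $w(a,k)\in\mathbb{Q}$ are the uniquely determined rational numbers with $$G_k=\sum_{4a+6b=k} w(a,k)\,G_4^aG_6^b,$$ the sum being over integers $a,b\ge 0$ with $4a+6b=k$. Here $v_2$ is the 2-adic valuation on $\mathbb{Q}$ (with $v_2(0)=+\infty$), and $s(n)$ is the number of ones in the binary expansion of the nonnegative integer $n$. *)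

(* Defs.v *)
From mathcomp Require Import all_boot all_order all_algebra.
From mathcomp Require Import all_classical all_reals ereal topology normedtype sequences.
From mathcomp.analysis.showcase Require Import summability.
From mathcomp.real_closed Require Import complex.

Set Implicit Arguments.
Unset Strict Implicit.
Unset Printing Implicit Defensive.

Import Order.TTheory GRing.Theory Num.Theory.
Import numFieldNormedType.Exports.

Local Open Scope ring_scope.
Local Open Scope classical_set_scope.
Local Open Scope complex_scope.

(* Unconditional sum over the pairs of coprime integers.  It converges
   absolutely for k >= 3 and z in the upper half-plane; elsewhere [sum] may
   be a junk value. *)
Definition eisensteinE (R : realType) (k : nat) (z : R[i]) : R[i] :=
  2^-1 * sum (fun p : {p : int * int | coprimez p.1 p.2} =>
                ((val p).1%:~R * z + (val p).2%:~R) ^- k : R[i]^o).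

(* Only meant for integers k >= 2, where the series converges. *)
Definition zeta (R : realType) (k : nat) : R :=
  limn (series (fun n : nat => n.+1%:R ^- k : R)).

Definition eisensteinG (R : realType) (k : nat) (z : R[i]) : R[i] :=
  2 * (zeta R k)%:C * eisensteinE k z.

(* c a is the coefficient of G_4^a G_6^b, where b is determined by a and k;
   the values of c at the other a are unconstrained. *)
Definition is_Gexpansion (R : realType) (k : nat) (c : nat -> rat) : Prop :=
  forall z : R[i], 0 < complex.Im z ->
    eisensteinG k z =
    \sum_(a < k.+1) \sum_(b < k.+1 | (4 * a + 6 * b == k)%N)
       ratr (c a) * eisensteinG 4 z ^+ a * eisensteinG 6 z ^+ b.

(* The coefficients w(a, k), as a definite description: the default value 0
   would only be used if no expansion existed. *)
Definition w (R : realType) (a k : nat) : rat :=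
  xget (fun=> 0) [set c | is_Gexpansion R k c] a.

Definition v2 (q : rat) : \bar int :=
  if q == 0 then +oo%E
  else ((logn 2 `|numq q|)%:Z - (logn 2 `|denq q|)%:Z)%:E.

(* The digits of n of index i >= n vanish since n < 2 ^ n. *)
Definition binary_ones (n : nat) : nat := (\sum_(i < n) (n %/ 2 ^ i) %% 2)%N.

(* Main.v *)
Require Import Defs.
From HB Require Import structures.
From mathcomp Require Import all_boot all_order all_algebra finmap.
From mathcomp Require Import all_classical all_reals ereal topology normedtype sequences.
From mathcomp.analysis.showcase Require Import summability.
From mathcomp.real_closed Require Import complex.
From mathcomp Require Import ring lra zify.

(* Write wp(s) = s^-2 + sum_m e_m s^(2 m - 2) for the Weierstrass function of the
   lattice Zz + Z, so that e_m = (2 m - 1) G_{2 m}.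

   Recursion.  Expanding ((s - u) (s - v)) ^ -3 into partial fractions and summing
   the coefficients of the powers of s over all pairs of lattice points, where only
   exponents at least 3 occur, gives wp'''' = 30 wp'^2 + 12 g_2 wp + const without
   any conditionally convergent series.  Hence e_m is a rational polynomial in
   e_2 = 3 G_4 and e_3 = 5 G_6, and wp'' = 6 wp^2 - g_2 / 2 follows formally.

   Valuation.  Put e_m = 2 ^ (m - 2) / m! * h_m.  The two equations combine to
   (2 m - 3) (2 m + 1) h_m
     = 15 (e_2 h_{m-2} + sum_i 'C(m - 3, i) h_{i+1} h_{m-1-i}),
   so h_m is integral at 2.  Modulo 2, h_m is the power sum x^m + y^m + (x + y)^m of
   the roots of T^3 + e_2 T + e_3, which vanishes only when m is a power of 2.  Since
   2 ^ (m - 2) / m! has valuation s(m) - 2, this settles the other values of m; for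
   powers of 2, wp'' = 6 wp^2 - g_2 / 2 gives e_m = e_{m/2}^2 modulo 2.

   Uniqueness.  On the imaginary axis G_6 has a last zero, where G_4 does not vanish
   because otherwise all the G_k would.  In a linear relation between the
   G_4^a G_6^b one divides by the smallest power of G_6 and tends to this zero. *)
Set Implicit Arguments.
Unset Strict Implicit.
Unset Printing Implicit Defensive.

Import Order.TTheory GRing.Theory Num.Theory.
Import numFieldNormedType.Exports.

Local Open Scope ring_scope.

(** The sum of e_m s^(2 m) is 1/4 times the sum of h_m (2 s^2)^m / m!, an exponential series in 2
    s^2. Products of such series have binomial, hence integral, convolution coefficients, and the
    factors 2 m - 3 and 2 m + 1 are odd, so no division by 2 remains. The cubic T^3 + e_2 T + e_3 is
    the reduction modulo 2 of (4 T^3 - g_2 T - g_3) / 4 = T^3 - 5 e_2 T - 7 e_3. When m is a power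
    of 2, the factor 2^(m - 2) / m! has valuation -1 while h_m vanishes modulo 2, so h_m alone
    leaves the valuation undecided. Valuations are computed for universal polynomials in formal
    variables e_2 and e_3. Analysis only shows that the lattice sums obey the recursion and that the
    w(a, k) are unique. Passing from e_m to G_k costs the odd numbers 3, 5 and k - 1. *)

Local Notation Q2 := {poly {poly rat}}.
Local Notation Z2 := {poly {poly int}}.
Local Notation F2X := {poly 'F_2}.

(** * The differential equations of wp *)

(* The equation wp'''' = 30 wp'^2 + 12 g_2 wp + const in degree m = q + 4, with
   g_2 = 20 e_2.  It is used for sequences with e 0 = e 1 = 0, so that the truncated
   predecessors are harmless. *)
Definition wp_rec (F : pzRingType) (e : nat -> F) := forall q,
  ((q + 3) * (2 * q + 9) * (2 * q ^ 2 + 3 * q + 10))%:R * e q.+4 =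
  30 * (\sum_(i < q.+4.+1) (i.-1 * (q.+4 - i).-1)%:R * (e i * e (q.+4 - i)%N))
  + 60 * (e 2%N * e q.+2).

(* With wp = w / z ^ 2, D = (z / 2) d/dz and a = g_2 z ^ 4 / 20, this is
   (wp'''' - 30 wp' ^ 2 - 12 g_2 wp)' = E''' + 12 wp E' - 24 wp' E
   for E = wp'' - 6 wp ^ 2 + g_2 / 2. *)
Lemma derivation_ode (P : comPzRingType) (D : P -> P) (w a : P)
    (ode2 := 4 * D (D w) - 10 * D w + 6 * w - 6 * (w * w) + 10 * a)
    (ode4 := 16 * D (D (D (D w))) - 112 * D (D (D w)) + 284 * D (D w) - 308 * D w + 120 * w
       - 120 * ((D w - w) * (D w - w)) - 240 * (a * w)) :
  {morph D : p q / p - q} -> {morph D : p q / p + q} ->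
  (forall p q, D (p * q) = D p * q + p * D q) ->
  (forall n p, D (n%:R * p) = n%:R * D p) -> D a = 2 * a ->
  2 * D ode4 - 6 * ode4 = 8 * D (D (D ode2)) - 60 * D (D ode2) + 148 * D ode2 - 120 * ode2
    + 12 * (w * (2 * D ode2 - 4 * ode2)) - 48 * ((D w - w) * ode2).
Proof.
move=> DB DD DM Dn Da.
have E1 : D ode2 = 4 * D (D (D w)) - 10 * D (D w) + 6 * D w - 12 * (w * D w) + 20 * a.
  by rewrite /ode2 !(DB, DD, Dn) DM Da; ring.
have E2 : D (D ode2) = 4 * D (D (D (D w))) - 10 * D (D (D w)) + 6 * D (D w)
    - 12 * (D w * D w + w * D (D w)) + 40 * a.
  by rewrite E1 !(DB, DD, Dn) DM Da; ring.
have E3 : D (D (D ode2)) = 4 * D (D (D (D (D w)))) - 10 * D (D (D (D w))) + 6 * D (D (D w))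
    - 12 * (3 * (D w * D (D w)) + w * D (D (D w))) + 80 * a.
  by rewrite E2 !(DB, DD, Dn) !DM Da; ring.
by rewrite E3 E2 E1 /ode4 !(DB, DD, Dn) !DM Da !DB /ode2; ring.
Qed.

Section Formal.
Variable F : idomainType.
Hypothesis char0 : forall n, n.+1%:R != 0 :> F.
Variable e : nat -> F.
Hypotheses (e0 : e 0%N = 0) (e1 : e 1%N = 0) (erec : wp_rec e).

Definition theta (p : {poly F}) := 'X * p^`().

Lemma coef_theta p m : (theta p)`_m = m%:R * p`_m.
Proof.
by rewrite /theta coefXM coef_deriv; case: m => [|m]; rewrite ?mul0r //= mulr_natl.
Qed.

Lemma thetaD p q : theta (p + q) = theta p + theta q.
Proof. by rewrite /theta derivD mulrDr. Qed.

Lemma thetaB p q : theta (p - q) = theta p - theta q.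
Proof. by rewrite /theta derivB mulrBr. Qed.

Lemma thetaM p q : theta (p * q) = theta p * q + p * theta q.
Proof. by rewrite /theta derivM; ring. Qed.

Lemma thetaMn n p : theta (n%:R * p) = n%:R * theta p.
Proof. by rewrite /theta mulr_natl derivMn !mulr_natl mulrnAr. Qed.

Lemma thetaC c : theta c%:P = 0.
Proof. by rewrite /theta derivC mulr0. Qed.

Lemma thetaX : theta 'X = 'X.
Proof. by rewrite /theta derivX mulr1. Qed.

Lemma sum_ends (f : nat -> F) n :
  \sum_(i < n.+2) f i = f 0%N + f n.+1 + \sum_(i < n) f i.+1.
Proof. by rewrite big_ord_recl big_ord_recr /= [X in _ + X]addrC addrA; congr (_ + _). Qed.

(** The value 1 at index 0 is the pole of wp: [w N] is s^2 wp(s) truncated at degree N in the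
    variable s^2, and [theta] is (s / 2) d/ds. *)
Let w' i := if i == 0%N then 1 else e i.
Let w N := \poly_(i < N.+1) w' i.
Let A := e 2%N.

Let ode2 N := 4 * theta (theta (w N)) - 10 * theta (w N) + 6 * w N - 6 * (w N * w N)
  + 10 * (A%:P * ('X * 'X)).

Let ode4 N := 16 * theta (theta (theta (theta (w N)))) - 112 * theta (theta (theta (w N)))
  + 284 * theta (theta (w N)) - 308 * theta (w N) + 120 * w N
  - 120 * ((theta (w N) - w N) * (theta (w N) - w N)) - 240 * (A%:P * ('X * 'X) * w N).

Lemma ode4_deriv N : 2 * theta (ode4 N) - 6 * ode4 N =
  8 * theta (theta (theta (ode2 N))) - 60 * theta (theta (ode2 N)) + 148 * theta (ode2 N)
  - 120 * ode2 N + 12 * (w N * (2 * theta (ode2 N) - 4 * ode2 N))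
  - 48 * ((theta (w N) - w N) * ode2 N).
Proof.
apply: derivation_ode; [exact: thetaB|exact: thetaD|exact: thetaM|exact: thetaMn|].
by rewrite !thetaM thetaC thetaX; ring.
Qed.

Lemma coef_w N i : (i <= N)%N -> (w N)`_i = w' i.
Proof. by move=> iN; rewrite coef_poly ltnS iN. Qed.

Lemma coef_natM n (p : {poly F}) m : (n%:R * p)`_m = n%:R * p`_m.
Proof. by rewrite mulr_natl coefMn mulr_natl. Qed.

Lemma coef_sqr_w N m : (1 < m)%N -> (m <= N)%N ->
  (w N * w N)`_m = 2 * e m + \sum_(i < m.+1) e i * e (m - i)%N.
Proof.
case: m => // m m0 mN; rewrite coefM (sum_ends (fun i => _`_i * _`_(_ - i))).
rewrite (sum_ends (fun i => e i * e (_ - i)%N)) !subnn !subn0 !coef_w // /w' /= e0.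
rewrite !mul0r mulr0 !add0r mul1r mulr1 mulr_natl mulr2n; congr (_ + _).
apply: eq_bigr => i _; have im := ltn_ord i.
by rewrite !coef_w ?subSS /w' /=; [rewrite subn_eq0 leqNgt im|lia..].
Qed.

Lemma coef_sqr_theta N m : (1 < m)%N -> (m <= N)%N ->
  ((theta (w N) - w N) * (theta (w N) - w N))`_m =
  - 2 * (m%:R - 1) * e m + \sum_(i < m.+1) (i.-1 * (m - i).-1)%:R * (e i * e (m - i)%N).
Proof.
case: m => // m m0 mN; rewrite coefM (sum_ends (fun i => _`_i * _`_(_ - i))).
rewrite (sum_ends (fun i => (i.-1 * (_ - i).-1)%:R * (e i * e (_ - i)%N))).
rewrite !subnn !subn0 !coefB !coef_theta !coef_w // /w' /= e0.
rewrite !(mul0r, mulr0) !add0r; congr (_ + _); first by ring.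
apply: eq_bigr => i _; have im := ltn_ord i.
rewrite !coefB !coef_theta !coef_w ?subSS /w' /=; [|lia..].
rewrite subn_eq0 leqNgt im /= natrM (_ : m - i = (m - i).-1.+1)%N /=; last by lia.
by rewrite -!natr1; ring.
Qed.

(** Degrees start at 4 because s^6 times the additive constant of the equation for wp'''' sits in
    degree 3. *)
Lemma coef_ode4 N q : (q.+4 <= N)%N -> (ode4 N)`_(q.+4) = 0.
Proof.
move=> qN; rewrite /ode4 (_ : A%:P * ('X * 'X) * w N = A%:P * ('X^2 * w N)); last by rewrite expr2; ring.
rewrite !(coefB, coefD) !coef_natM !coef_theta coef_sqr_theta // coef_w //.
rewrite coefCM coefXnM /= !subSS subn0 coef_w; last by lia.
rewrite /w' /= -/A.
have h : (q%:R + 3) * (2 * q%:R + 9) * (2 * q%:R ^+ 2 + 3 * q%:R + 10) * e q.+4 =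
    30 * (\sum_(i < q.+4.+1) (i.-1 * (q.+4 - i).-1)%:R * (e i * e (q.+4 - i)%N)) + 60 * (A * e q.+2).
  by rewrite -erec !(natrD, natrM, natrX).
have -> : q.+4%:R = q%:R + 4 :> F by rewrite -addn4 natrD.
move: (\sum_(i < _) _) (q%:R) (e q.+4) (e q.+2) h => S x y t h.
rewrite (_ : _ - 240 * _ = 4 * ((x + 3) * (2 * x + 9) * (2 * x ^+ 2 + 3 * x + 10) * y - (30 * S + 60 * (A * t)))); last by ring.
by rewrite h subrr mulr0.
Qed.

Lemma coefM_low (p r : {poly F}) m : (forall i, (i < m)%N -> r`_i = 0) ->
  (p * r)`_m = p`_0 * r`_m.
Proof.
move=> r0; rewrite coefM big_ord_recl subn0 big1 ?addr0 // => i _.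
by rewrite lift0 r0 ?mulr0 //; have := ltn_ord i; lia.
Qed.

(** Strong induction: in degree q + 4 the left side of [ode4_deriv] vanishes. On the right only the
    coefficient of [ode2] in that degree survives, the products contributing the constant terms 1 of
    [w N] and -1 of [theta (w N) - w N]. *)
Lemma ode2_eq0 N m : (m <= N)%N -> (ode2 N)`_m = 0.
Proof.
have ode2E i : (i <= N)%N -> (ode2 N)`_i = (4 * i%:R ^+ 2 - 10 * i%:R + 6) * w' i - 6 * (w N * w N)`_i + 10 * (A * ('X^2)`_i).
  move=> iN; rewrite /ode2 !(coefB, coefD) !coef_natM !coef_theta coefCM -expr2 coef_w //; ring.
elim/ltn_ind: m => m IH mN.
have [m4|] := ltnP m 4; last first; move: mN.
  case: m IH => [|[|[|[|q]]]] // IH qN _.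
  have IHr i : (i < q.+4)%N -> (ode2 N)`_i = 0 by move=> iq; apply: IH => //; lia.
  have := ode4_deriv N; have := coef_ode4 qN.
  move: (ode2 N) (ode4 N) IHr => r s IHr s0.
  move/(congr1 (fun p : {poly F} => p`_(q.+4))).
  rewrite !(coefB, coefD) !coef_natM !coef_theta s0 !mulr0 subr0.
  rewrite coefM_low => [|i iq]; last first.
    by rewrite coefB !coef_natM coef_theta IHr ?mulr0 ?subr0.
  rewrite coefM_low //.
  rewrite !coefB !coef_natM !coef_theta coef_w // /w' /= => h.
  (* With m = q + 4 the factor is 8 m^3 - 60 m^2 + 172 m - 120, written as a successor for
     [char0]. *)
  have /eqP : (8 * q ^ 3 + 36 * q ^ 2 + 76 * q + 119).+1%:R * r`_(q.+4) = 0.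
    rewrite -natr1 !(natrD, natrM, natrX); move: h.
    have -> : q.+4%:R = q%:R + 4 :> F by rewrite -addn4 natrD.
    by move: (q%:R) (r`__) => x y h; rewrite [RHS]h; ring.
  rewrite mulf_eq0 => /orP[hc|/eqP //].
  by have := char0 (8 * q ^ 3 + 36 * q ^ 2 + 76 * q + 119); rewrite hc.

(* In degrees 0 to 3 the equation holds whatever e_2 and e_3 are. *)
move=> mN; rewrite ode2E // coefXn; case: m m4 mN {IH} => [|[|[|[|//]]]] _ mN;
  rewrite coefM !big_ord_recl big_ord0 /= ?coef_w //; try (rewrite /bump; lia);
  rewrite /w' /= ?e0 ?e1 /A; ring.
Qed.

Lemma wp_rec_ode m : (1 < m)%N ->
  (2 * m%:R + 1) * (m%:R - 3) * e m = 3 * \sum_(i < m.+1) e i * e (m - i)%N - 5 * ((m == 2)%:R * A).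
Proof.
move=> m1; have := ode2_eq0 (leqnn m).
rewrite /ode2 !(coefB, coefD) !coef_natM !coef_theta coefCM -['X * 'X]expr2 coefXn coef_w // coef_sqr_w //.
rewrite /w' eqn0Ngt (ltnW m1) /= => h.
have two : 2%:R != 0 :> F by exact: char0.
apply: (mulfI two); apply/eqP; rewrite -subr_eq0; apply/eqP; rewrite -[RHS]h; ring.
Qed.

(** Since (i - 1) (m - i - 1) = i (m - i) - (m - 1), the unweighted convolution can be eliminated
    with [wp_rec_ode]. The weights i (m - i) are those that fit the factorials in h_m. *)
Lemma wp_rec_ode_weighted m : (3 < m)%N ->
  m%:R * (m%:R - 1) * (2 * m%:R + 1) * (2 * m%:R - 3) * e m =
  60 * (A * e (m - 2)%N) + 30 * \sum_(i < m.+1) (i * (m - i))%:R * (e i * e (m - i)%N).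
Proof.
case: m => [|[|[|[|q]]]] // _.
have := wp_rec_ode (isT : 1 < q.+4)%N; rewrite mul0r mulr0 subr0 => R1.
have := erec q; rewrite -/A /= !subSS subn0.
rewrite (eq_bigr (fun i : 'I_q.+4.+1 => (i * (q.+4 - i))%:R * (e i * e (q.+4 - i)%N)
   - (q%:R + 3) * (e i * e (q.+4 - i)%N))); last first.
  move=> i _; case: i => [[|i] ilt] /=; first by rewrite e0; ring.
  have [im|im] := eqVneq i q.+3; first by rewrite im subnn e0; ring.
  have -> : (q.+4 - i.+1 = (q.+4 - i.+1).-1.+1)%N by lia.
  rewrite /= !natrM -[i.+1%:R]natr1 -[(_.-1.+1)%:R]natr1.
  have -> : q%:R + 3 = i%:R + ((q.+4 - i.+1).-1)%:R + 1 :> F.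
    by rewrite -[3]/(3%:R) -[1]/(1%:R) -!natrD; congr _%:R; lia.
  ring.
rewrite sumrB -mulr_sumr; move: R1.
rewrite !(natrD, natrM, natrX) -[q.+4]addn4 natrD.
move: (\sum_(i < _) _) (\sum_(i < _) _) => W S R1 R4.
have -> : 30 * W = 30 * (W - (q%:R + 3) * S) + 60 * (A * e q.+2) - 60 * (A * e q.+2) + 10 * (q%:R + 3) * (3 * S) by ring.
rewrite -R4 -R1; ring.
Qed.

End Formal.

(** * The universal coefficients of wp *)

Definition wp_den q := ((q + 3) * (2 * q + 9) * (2 * q ^ 2 + 3 * q + 10))%N.

Lemma wp_den_neq0 (F : idomainType) : (forall n, n.+1%:R != 0 :> F) ->
  forall q, (wp_den q)%:R != 0 :> F.
Proof.
move=> c0 q; have : (0 < wp_den q)%N by rewrite /wp_den !muln_gt0; lia.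
by case: (wp_den q) => // n _; exact: c0.
Qed.

Lemma wp_rec_unique (F : idomainType) (e f : nat -> F) : (forall n, n.+1%:R != 0 :> F) ->
  wp_rec e -> wp_rec f -> (forall i, (i < 4)%N -> e i = f i) -> e =1 f.
Proof.
move=> c0 re rf ef m; elim/ltn_ind: m => m IH.
have [/ef//|] := ltnP m 4; case: m IH => [|[|[|[|q]]]] // IH _.
apply: (mulfI (wp_den_neq0 c0 q)); rewrite re rf !IH //.
congr (30 * _ + _); apply: eq_bigr => i _.
case: i => [[|i] ilt] /=; first by rewrite mul0n !mul0r.
have [->|iq] := eqVneq i q.+3; first by rewrite subnn muln0 !mul0r.
by rewrite !IH //; lia.
Qed.

Section Universal.
Let X : Q2 := 'X.
Let Y : Q2 := 'X%:P.

Definition wp_step (f : nat -> Q2) m : Q2 := match m with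
  | 0 | 1 => 0 | 2 => X | 3 => Y
  | q.+4 => ((wp_den q)%:R^-1)%:P%:P *
      (30 * (\sum_(i < q.+4.+1) (i.-1 * (q.+4 - i).-1)%:R * (f i * f (q.+4 - i)%N)) + 60 * (f 2%N * f q.+2))
  end.

(** A structural form of course-of-values recursion: [wp_tab n] holds the values below n. In the sum
    of [wp_step] the index m itself occurs only with weight 0. *)
Fixpoint wp_tab n : nat -> Q2 :=
  if n is n'.+1 then fun m => if m == n' then wp_step (wp_tab n') m else wp_tab n' m else fun=> 0.

(* [wpU m] is [e_m] as a polynomial in [e_2 = 'X] and [e_3 = 'X%:P]. *)
Definition wpU m := wp_tab m.+1 m.

Lemma wp_tabE n m : (m < n)%N -> wp_tab n m = wpU m.
Proof.
elim: n => // n IH; rewrite ltnS leq_eqVlt => /orP[/eqP -> //|mn].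
by rewrite /= ltn_eqF // IH.
Qed.

Lemma wpUE m : wpU m = wp_step (wp_tab m) m.
Proof. by rewrite /wpU /= eqxx. Qed.

Lemma Q2_char0 n : n.+1%:R != 0 :> Q2.
Proof. by rewrite -[n.+1%:R](rmorph_nat polyC) -(rmorph_nat polyC) !polyC_eq0 pnatr_eq0. Qed.

Lemma wpU_rec : wp_rec wpU.
Proof.
move=> q; rewrite -/(wp_den q) wpUE [LHS]mulrA.
have -> : (wp_den q)%:R * ((wp_den q)%:R^-1)%:P%:P = 1 :> Q2.
  rewrite -[(wp_den q)%:R](rmorph_nat polyC) -(rmorph_nat polyC) -!rmorphM /= mulfV ?rmorph1 //.
  by apply: wp_den_neq0 => n; rewrite pnatr_eq0.
rewrite mul1r !wp_tabE //.
congr (30 * _ + _); apply: eq_bigr => i _.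
case: i => [[|i] ilt]; cbn [nat_of_ord]; first by rewrite mul0n !mul0r.
have [->|iq] := eqVneq i q.+3; first by rewrite subnn muln0 !mul0r.
by rewrite !wp_tabE //; lia.
Qed.

Lemma wpU0 : wpU 0 = 0. Proof. by []. Qed.
Lemma wpU1 : wpU 1 = 0. Proof. by []. Qed.
Lemma wpU2 : wpU 2 = X. Proof. by []. Qed.
Lemma wpU3 : wpU 3 = Y. Proof. by []. Qed.

(** The weight of e_2^a e_3^b is half the weight 4 a + 6 b of G_4^a G_6^b. *)
Definition homog m (p : Q2) := forall a b, (2 * a + 3 * b != m)%N -> p`_a`_b = 0.

Lemma homogD m p q : homog m p -> homog m q -> homog m (p + q).
Proof. by move=> hp hq a b ab; rewrite !coefD hp ?hq ?addr0. Qed.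

Lemma homog0 m : homog m 0.
Proof. by move=> a b _; rewrite !coef0. Qed.

Lemma homogM m n p q : homog m p -> homog n q -> homog (m + n) (p * q).
Proof.
move=> hp hq a b ab; rewrite coefM coef_sum big1 // => i _.
rewrite coefM big1 // => j _.
have [e1|e1] := eqVneq (2 * i + 3 * j)%N m; last by rewrite hp ?mul0r.
rewrite [X in _ * X]hq ?mulr0 //; apply: contra ab => /eqP e2; apply/eqP.
by have := ltn_ord i; have := ltn_ord j; lia.
Qed.

Lemma homogC m c p : homog m p -> homog m (c%:P%:P * p).
Proof. by move=> hp a b ab; rewrite !coefCM hp ?mulr0. Qed.

Lemma homog_nat m n p : homog m p -> homog m (n%:R * p).
Proof. by move=> hp a b ab; rewrite mulr_natl !coefMn hp ?mul0rn. Qed.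

Lemma homog_wpU m : homog m (wpU m).
Proof.
elim/ltn_ind: m => m IH; rewrite wpUE; case: m IH => [|[|[|[|q]]]] IH.
- exact: homog0.
- exact: homog0.
- move=> a b; rewrite /= coefX; case: (eqVneq a 1%N) => [->|_] ab; last by rewrite coef0.
  by rewrite coef1; case: b ab.
- move=> a b; rewrite /= coefC; case: a => [|a] /= ab; last by rewrite coef0.
  by rewrite coefX; case: (eqVneq b 1%N) ab => [->|].
apply/homogC/homogD; apply: homog_nat.
  apply: (big_ind (homog q.+4)); [exact: homog0|exact: homogD|move=> i _].
  case: i => [[|i] ilt]; cbn [nat_of_ord]; first by rewrite mul0n mul0r; exact: homog0.
  have [->|iq] := eqVneq i q.+3; first by rewrite subnn muln0 mul0r; exact: homog0.
  apply: homog_nat; rewrite !wp_tabE; [|lia..].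
  have {1}-> : (q.+4 = i.+1 + (q.+4 - i.+1))%N by lia.
  by apply: homogM; apply: IH; lia.
by rewrite !wp_tabE //; apply: (@homogM 2 q.+2); apply: IH; lia.
Qed.

End Universal.

(** * The binomial recursion for h_m, and power sums in characteristic 2 *)

Lemma sum_bin_sym (F : comPzRingType) (a : nat -> F) n :
  \sum_(i < n.+2) 'C(n.+1, i)%:R * (a i * a (n.+1 - i)%N) =
  2%:R * \sum_(i < n.+1) 'C(n, i)%:R * (a i * a (n.+1 - i)%N).
Proof.
rewrite big_ord_recl bin0.
under eq_bigr do rewrite lift0 binS natrD mulrDl subSS.
rewrite big_split addrA /= [RHS]mulr_natl mulr2n; congr (_ + _).
  rewrite [LHS](_ : _ = \sum_(i < n.+2) 'C(n, i)%:R * (a i * a (n.+1 - i)%N)).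
    by rewrite big_ord_recr /= bin_small // mul0r addr0.
  by rewrite [RHS]big_ord_recl bin0; congr (_ + _); apply: eq_bigr => i _; rewrite lift0 subSS.
rewrite (reindex_inj rev_ord_inj) /=; apply: eq_bigr => i _.
have iN : (i <= n)%N by rewrite -ltnS.
by rewrite subSS bin_sub // subKn // subSn // [a _ * _]mulrC.
Qed.

Section Hurwitz.
Variable F : idomainType.
Hypothesis char0 : forall n, n.+1%:R != 0 :> F.
Variables e h : nat -> F.
Hypotheses (e0 : e 0%N = 0) (e1 : e 1%N = 0) (erec : wp_rec e).
Hypothesis he : forall m, 2 ^+ m.-2 * h m = m`!%:R * e m.

(** As i e_i = 2^(i - 2) h_i / (i - 1)!, the weights i (m - i) leave the factorials of i - 1 and m -
    i - 1, which (m - 2)! completes to a binomial coefficient. *)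
Lemma hurwitz_conv n :
  (n.+2)`!%:R * \sum_(i < n.+4.+1) (i * (n.+4 - i))%:R * (e i * e (n.+4 - i)%N) =
  2 ^+ n * \sum_(i < n.+3) 'C(n.+2, i)%:R * (h i.+1 * h (n.+2 - i).+1).
Proof.
have h1 : h 1%N = 0 by have := he 1; rewrite e1 mulr0 expr0 mul1r.
rewrite big_ord_recl big_ord_recr /= subnn e0 !(mul0r, mulr0) add0r addr0.
rewrite !mulr_sumr; apply: eq_bigr => i _; rewrite /bump /= add1n subSS.
have i3 : (i <= n.+2)%N by rewrite -ltnS.
have -> : (n.+3 - i = (n.+2 - i).+1)%N by lia.
(* At both ends the truncated exponents do not add up to n, but there e_1 = h_1 = 0. *)
have [->|i0] := posnP (nat_of_ord i); first by rewrite e1 h1; ring.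
have [->|i2] := eqVneq (nat_of_ord i) n.+2; first by rewrite subnn e1 h1; ring.
rewrite -(bin_fact i3) !natrM.
have := he i.+1; rewrite /= factS natrM => hi.
have := he (n.+2 - i).+1; rewrite /= factS natrM => hj.
have -> : 2 ^+ n = 2 ^+ i.-1 * 2 ^+ (n.+2 - i).-1 :> F by rewrite -exprD; congr (_ ^+ _); lia.
transitivity ('C(n.+2, i)%:R * ((i.+1%:R * i`!%:R * e i.+1) * ((n.+2 - i).+1%:R * (n.+2 - i)`!%:R * e (n.+2 - i).+1))).
  by ring.
by rewrite -hi -hj; ring.
Qed.

Lemma hurwitz_rec n : (2 * n + 5)%:R * ((2 * n + 9)%:R * h n.+4) =
  15%:R * (e 2%N * h n.+2 + \sum_(i < n.+2) 'C(n.+1, i)%:R * (h i.+1 * h (n.+3 - i)%N)).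
Proof.
have two : 2 != 0 :> F by exact: char0.
have := wp_rec_ode_weighted char0 e0 e1 erec (isT : 3 < n.+4)%N; have := hurwitz_conv n.
(* The factor 2 gained here turns 30 * 2 ^ n into 15 * 2 ^ n.+2, so the power of 2 cancels
   exactly. *)
rewrite (sum_bin_sym (fun i => h i.+1)).
have -> : \sum_(i < n.+2) 'C(n.+1, i)%:R * (h i.+1 * h (n.+2 - i).+1) =
    \sum_(i < n.+2) 'C(n.+1, i)%:R * (h i.+1 * h (n.+3 - i)%N).
  by apply: eq_bigr => i _; rewrite -subSn ?(ltnW (ltn_ord i)).
move: (\sum_(i < _) _) (\sum_(i < _) _) => T S TE E.
rewrite -[(n.+4 - 2)%N]/n.+2 in E.
have h2 : 2 ^+ n * h n.+2 = (n.+2)`!%:R * e n.+2 by exact: he n.+2.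
have h4 : 2 ^+ n.+2 * h n.+4 = n.+4%:R * (n.+3%:R * (n.+2)`!%:R) * e n.+4.
  by rewrite (he n.+4) factS [n.+3`!]factS !natrM.
move: ((n.+2)`!%:R) h2 h4 TE => f h2 h4 TE.
apply: (mulfI (expf_neq0 n.+2 two)).
have -> : 2 ^+ n.+2 * (15%:R * (e 2%N * h n.+2 + T)) =
  60 * (e 2%N * (2 ^+ n * h n.+2)) + 30 * (2 ^+ n * (2%:R * T)) by rewrite !exprS; ring.
rewrite h2 -TE mulrCA [X in _ * X]mulrCA h4.
move: E; rewrite -[n.+4]addn4 -[n.+3]addn3 !natrD => E.
transitivity (f * ((n%:R + 4) * (n%:R + 4 - 1) * (2 * (n%:R + 4) + 1) * (2 * (n%:R + 4) - 3) * e (n + 4)%N)).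
  by rewrite ?natrM; ring.
by rewrite E; ring.
Qed.

End Hurwitz.

Section PowerSums.
Variables (K : comNzRingType) (x y : K).
Hypothesis char2 : 2%:R = 0 :> K.

Definition psum m : K := x ^+ m + y ^+ m + (x + y) ^+ m.

Lemma sum_binom_shift n (a b : K) :
  \sum_(i < n.+1) 'C(n, i)%:R * (a ^+ i.+1 * b ^+ (n.+2 - i)) = a * b ^+ 2 * (a + b) ^+ n.
Proof.
rewrite addrC exprDn mulr_sumr; apply: eq_bigr => i _.
have -> : (n.+2 - i = n - i + 2)%N by have := ltn_ord i; lia.
by rewrite exprS exprD -mulr_natl; ring.
Qed.

(** By the binomial theorem a pair of roots a, b contributes a b^2 (a + b)^(n + 1). Diagonal pairs
    vanish in characteristic 2 and otherwise a + b is the third root, so the convolution equals x y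
    (x + y) times the power sum of order n + 1. What remains is Newton's identity. *)
Lemma psum_rec n : psum n.+4 = (x * y + (x + y) ^+ 2) * psum n.+2 +
  \sum_(i < n.+2) 'C(n.+1, i)%:R * (psum i.+1 * psum (n.+3 - i)).
Proof.
have -> : \sum_(i < n.+2) 'C(n.+1, i)%:R * (psum i.+1 * psum (n.+3 - i)) =
  \sum_(a <- [:: x; y; x + y]) \sum_(b <- [:: x; y; x + y]) a * b ^+ 2 * (a + b) ^+ n.+1.
  under [RHS]eq_bigr do under eq_bigr do rewrite -sum_binom_shift.
  under [RHS]eq_bigr do rewrite exchange_big.
  rewrite [RHS]exchange_big; apply: eq_bigr => i _.
  rewrite !big_cons !big_nil /= /psum; move: (n.+3 - i)%N (i.+1)%N => l k.
  by move: (x ^+ k) (x ^+ l) (y ^+ k) (y ^+ l) ((x + y) ^+ k) ((x + y) ^+ l) => *; ring.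
have -> : \sum_(a <- [:: x; y; x + y]) \sum_(b <- [:: x; y; x + y]) a * b ^+ 2 * (a + b) ^+ n.+1 =
  x * y * (x + y) * ((x + y) ^+ n.+1 + x ^+ n.+1 + y ^+ n.+1).
  have d (a : K) : a + a = 0 by rewrite -mulr2n -mulr_natl char2 mul0r.
  have exy : x + (x + y) = y by rewrite addrA d add0r.
  have eyx : y + (x + y) = x by rewrite addrCA d addr0.
  rewrite !big_cons !big_nil !d exy eyx [y + x]addrC [x + y + x]addrC exy [x + y + y]addrC eyx.
  rewrite !expr0n /= !mulr0 !addr0 !add0r.

  move: (x ^+ n.+1) (y ^+ n.+1) ((x + y) ^+ n.+1) => a b c.
  transitivity (x * y * (x + y) * (c + a + b) + 2%:R * ((x + y) * (x ^+ 2 * b + y ^+ 2 * a))); first by ring.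
  by rewrite char2 mul0r addr0.
rewrite /psum -[n.+4]addn4 -[n.+2]addn2 -[n.+1]addn1 !exprD.
move: (x ^+ n) (y ^+ n) ((x + y) ^+ n) => a b c.
apply/eqP; rewrite -subr_eq0; apply/eqP.
rewrite [LHS](_ : _ = 2%:R * - (a * (2 * x ^+ 3 * y + x ^+ 2 * y ^+ 2) + b * (2 * x * y ^+ 3 + x ^+ 2 * y ^+ 2) + c * x * y * (x + y) ^+ 2)); first by rewrite char2 mul0r.
ring.
Qed.

End PowerSums.

(** * 2-adic valuations *)

Section TwoAdic.

(** The cubic is specialised to the roots 'X, 1 and 'X + 1. [redA] and [redB] are their second and
    third elementary symmetric functions, with the root 1 kept visible as in [psum_rec]. *)
Definition redA : F2X := 'X * 1 + ('X + 1) ^+ 2.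
Definition redB : F2X := 'X * 1 * ('X + 1).

Definition red_coef := horner_eval redB \o map_poly (intmul 1 : int -> F2X).
HB.instance Definition _ := GRing.RMorphism.on red_coef.
Definition red : Z2 -> F2X := horner_eval redA \o map_poly red_coef.
HB.instance Definition _ := GRing.RMorphism.on red.
Definition toQ : Z2 -> Q2 := map_poly (map_poly (intmul 1 : int -> rat)).
HB.instance Definition _ := GRing.RMorphism.on toQ.

Lemma toQD P R : toQ (P + R) = toQ P + toQ R. Proof. exact: rmorphD. Qed.
Lemma toQM P R : toQ (P * R) = toQ P * toQ R. Proof. exact: rmorphM. Qed.
Lemma toQ_nat n : toQ n%:R = n%:R. Proof. exact: rmorph_nat. Qed.
Lemma redD P R : red (P + R) = red P + red R. Proof. exact: rmorphD. Qed.
Lemma redM P R : red (P * R) = red P * red R. Proof. exact: rmorphM. Qed.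
Lemma red_nat n : red n%:R = n%:R. Proof. exact: rmorph_nat. Qed.

Lemma poly_F2_char2 : 2%:R = 0 :> F2X.
Proof. by rewrite -(rmorph_nat polyC) (_ : 2%:R = 0 :> 'F_2) ?rmorph0 //; apply/val_inj. Qed.

Lemma poly_F2_nat n : n%:R = (odd n)%:R :> F2X.
Proof. by rewrite -{1}(odd_double_half n) natrD -mul2n natrM poly_F2_char2 mul0r addr0. Qed.

(* [q] is integral at 2 and [x] is its reduction modulo 2. *)
Definition reduces (q : Q2) (x : F2X) :=
  exists n P, [/\ odd n, n%:R * q = toQ P & red P = x].

Lemma reducesD q r x y : reduces q x -> reduces r y -> reduces (q + r) (x + y).
Proof.
move=> [n [P [on nP <-]]] [m [R [om mR <-]]]; exists (n * m)%N, (m%:R * P + n%:R * R); split.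
- by rewrite oddM on om.
- by rewrite toQD 2!toQM 2!toQ_nat -nP -mR natrM mulrDr -2!mulrA; congr (_ + _); rewrite mulrCA.
- by rewrite redD !redM !red_nat (poly_F2_nat n) (poly_F2_nat m) on om !mul1r.
Qed.

Lemma reducesM q r x y : reduces q x -> reduces r y -> reduces (q * r) (x * y).
Proof.
move=> [n [P [on nP <-]]] [m [R [om mR <-]]]; exists (n * m)%N, (P * R); split.
- by rewrite oddM on om.
- by rewrite natrM toQM -nP -mR mulrACA.
- by rewrite redM.
Qed.

Lemma reduces_nat n : reduces n%:R n%:R.
Proof. by exists 1%N, n%:R; split => //; rewrite ?mul1r ?toQ_nat ?red_nat. Qed.

Lemma reducesX : reduces 'X redA.
Proof.
exists 1%N, 'X; split => //; first by rewrite mul1r /toQ map_polyX.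
by rewrite /red /= map_polyX /horner_eval hornerX.
Qed.

Lemma reducesY : reduces 'X%:P redB.
Proof.
exists 1%N, 'X%:P; split => //; first by rewrite mul1r /toQ map_polyC /= map_polyX.
by rewrite /red /red_coef /= map_polyC /= /horner_eval hornerC map_polyX hornerX.
Qed.

Lemma reduces_sum I (r : seq I) (P : pred I) (F : I -> Q2) (G : I -> F2X) :
  (forall i, P i -> reduces (F i) (G i)) ->
  reduces (\sum_(i <- r | P i) F i) (\sum_(i <- r | P i) G i).
Proof.
by move=> h; apply: (big_ind2 reduces) => //; [exact: (reduces_nat 0)|move=> *; exact: reducesD].
Qed.

Lemma reduces_div n q x : odd n -> reduces (n%:R * q) x -> reduces q x.
Proof.
move=> on [m [P [om mP Px]]]; exists (m * n)%N, P; split => //; first by rewrite oddM om on.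
by rewrite natrM -mulrA.
Qed.

Definition wpH m : Q2 := ((m`!%:R : rat) / 2 ^+ m.-2)%:P%:P * wpU m.

Lemma ratC_natM (n : nat) (c : rat) : ((n%:R * c)%:P)%:P = n%:R * (c%:P)%:P :> Q2.
Proof. by rewrite !rmorphM /= !rmorph_nat. Qed.

Lemma wpH_U m : 2 ^+ m.-2 * wpH m = m`!%:R * wpU m.
Proof.
rewrite /wpH mulrA -natrX -ratC_natM natrX mulrCA mulfV ?expf_neq0 // mulr1.
by rewrite -[m`!%:R]mulr1 ratC_natM !polyC1 mulr1.
Qed.

Lemma wpH_rec n : (2 * n + 5)%:R * ((2 * n + 9)%:R * wpH n.+4) =
  15%:R * ('X * wpH n.+2 + \sum_(i < n.+2) 'C(n.+1, i)%:R * (wpH i.+1 * wpH (n.+3 - i))).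
Proof. exact: (hurwitz_rec Q2_char0 wpU0 wpU1 wpU_rec wpH_U). Qed.

Lemma reduces_wpH m : (0 < m)%N -> reduces (wpH m) (psum 'X 1 m).
Proof.
elim/ltn_ind: m => m IH m0; have [m4|] := ltnP m 4; last first.
  case: m IH {m0} => [|[|[|[|n]]]] // IH _.
  apply: (@reduces_div (2 * n + 9)); first by lia.
  apply: (@reduces_div (2 * n + 5)); first by lia.
  rewrite wpH_rec psum_rec; last exact: poly_F2_char2.
  have e15 : 1 = 15%:R :> F2X by rewrite (poly_F2_nat 15).
  rewrite -[X in reduces _ X]mul1r [X in reduces _ (X * _)]e15.
  apply/reducesM; first exact: reduces_nat.
  apply: reducesD; first by apply: reducesM; [exact: reducesX|exact: IH].
  apply: reduces_sum => i _; have := ltn_ord i => il.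
  apply: reducesM; first exact: reduces_nat.
  by apply: reducesM; apply: IH; lia.
case: m m0 m4 {IH} => [|[|[|[|//]]]] // _ _.
- rewrite /wpH wpU1 mulr0 (_ : psum _ _ _ = 0); first exact: (reduces_nat 0).
  by rewrite /psum !expr1 -mulr2n -mulr_natl poly_F2_char2 mul0r.
- rewrite /wpH wpU2 expr0 divr1 -[_%:R]mulr1 ratC_natM !polyC1 mulr1.
  rewrite (_ : psum _ _ _ = 2%:R * redA); first exact: reducesM (reduces_nat 2) reducesX.
  rewrite poly_F2_char2 mul0r /psum.
  transitivity (2%:R * ('X ^+ 2 + 'X + 1) : F2X); first by ring.
  by rewrite poly_F2_char2 mul0r.
- rewrite /wpH wpU3 (_ : 3`!%:R / 2 ^+ 3.-2 = 3%:R * 1 :> rat) // ratC_natM !polyC1 mulr1.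
  rewrite (_ : psum _ _ _ = 3%:R * redB); first exact: reducesM (reduces_nat 3) reducesY.
  rewrite /psum /redB.
  have -> : 'X ^+ 3 + 1 ^+ 3 + ('X + 1) ^+ 3 = 3%:R * ('X * 1 * ('X + 1)) + 2%:R * ('X ^+ 3 + 1) :> F2X by ring.
  by rewrite poly_F2_char2 mul0r addr0.
Qed.

End TwoAdic.

(** * Binary digits, factorials and binomial coefficients; the valuation of e_m *)

Lemma half_sum n : (\sum_(i < n) n %/ 2 ^ i.+1)%N = logn 2 n`!.
Proof. by rewrite logn_fact // big_add1 big_mkord. Qed.

(** Legendre's formula: each quotient n / 2^i is a digit plus twice the next quotient. Summing over
    i gives n + v = s + 2 v, where v is the valuation of n! and s the digit sum. *)
Lemma logn_fact_binary_ones n : (logn 2 n`! + binary_ones n = n)%N.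
Proof.
have e i : (n %/ 2 ^ i = (n %/ 2 ^ i) %% 2 + 2 * (n %/ 2 ^ i.+1))%N.
  by rewrite expnSr divnMA addnC mulnC -divn_eq.
have S : (\sum_(i < n.+1) n %/ 2 ^ i = n + logn 2 n`!)%N.
  by rewrite -half_sum big_ord_recl expn0 divn1; congr (_ + _)%N.
have S' : (\sum_(i < n.+1) n %/ 2 ^ i = \sum_(i < n) n %/ 2 ^ i)%N.
  by rewrite big_ord_recr /= [X in (_ + X)%N]divn_small ?addn0 // ltn_expl.
have B : (\sum_(i < n) n %/ 2 ^ i = binary_ones n + 2 * logn 2 n`!)%N.
  by rewrite -half_sum big_distrr /= -big_split; apply: eq_bigr => i _; exact: e.
move: S; rewrite S' B; move: (logn _ _) (binary_ones n) => x y; lia.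
Qed.

Lemma fact_binary_ones n : exists2 u, odd u & (n`! * 2 ^ binary_ones n = u * 2 ^ n)%N.
Proof.
have [u ou e] := pfactor_coprime (isT : prime 2) (fact_gt0 n).
exists u; first by rewrite -coprime2n.
by rewrite {1}e -mulnA -expnD logn_fact_binary_ones.
Qed.

Lemma binary_ones_gt0 n : (0 < n)%N -> (0 < binary_ones n)%N.
Proof.
move=> n0; rewrite lt0n; apply/negP; rewrite sum_nat_eq0 => /forallP h.
have d i : (i <= n)%N -> (2 ^ i %| n)%N.
  elim: i => [|i IH] il; first by rewrite dvd1n.
  have := h (Ordinal il); rewrite /= => h2.
  by rewrite expnS -dvdn_divRL ?IH ?(ltnW il).
by have := dvdn_leq n0 (d n (leqnn n)); rewrite leqNgt ltn_expl.
Qed.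

(** Kummer's theorem in the case without carries, from Legendre's formula for three factorials. *)
Lemma binary_ones_odd_bin m i : (i <= m)%N -> odd 'C(m, i) ->
  binary_ones m = (binary_ones i + binary_ones (m - i))%N.
Proof.
move=> im oC; have := congr1 (logn 2) (bin_fact im).
rewrite !lognM ?muln_gt0 ?fact_gt0 ?bin_gt0 // (_ : logn 2 'C(m, i) = 0%N).
  have := logn_fact_binary_ones m; have := logn_fact_binary_ones i.
  have := logn_fact_binary_ones (m - i); lia.
by rewrite logn_coprime ?coprime2n.
Qed.

Lemma binary_ones_double n : binary_ones n.*2 = binary_ones n.
Proof.
have h : logn 2 (n.*2)`! = (n + logn 2 n`!)%N.
  elim: n => // n IH; rewrite doubleS !factS !lognM ?fact_gt0 //; last by rewrite muln_gt0 fact_gt0.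
  rewrite IH (_ : logn 2 n.*2.+1 = 0%N); last by rewrite logn_coprime ?coprime2n /= ?odd_double.
  by rewrite -doubleS -mul2n lognM // (pfactorK 1) //; lia.
have := logn_fact_binary_ones n; have := logn_fact_binary_ones n.*2; rewrite h; lia.
Qed.

Lemma coef_1pX (R : nzRingType) m i : (i <= m)%N -> ((1 + 'X : {poly R}) ^+ m)`_i = 'C(m, i)%:R.
Proof.
move=> im; rewrite addrC exprD1n coef_sum.
rewrite (bigD1 (Ordinal (im : (i < m.+1)%N))) //= coefMn coefXn eqxx big1 ?addr0 // => l li.
rewrite coefMn coefXn (_ : (i == l)%N = false) ?mul0rn //.
by apply/negbTE; apply: contra li => /eqP il; apply/eqP/val_inj.
Qed.

(** For m = o 2^j with o odd, (1 + X)^m = (1 + X^(2^j))^o modulo 2, so 'C(m, 2 ^ j) is congruent to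
    o. *)
Lemma two_power_or_odd_bin m : (0 < m)%N -> (exists j, m = 2 ^ j)%N \/
  exists i, [/\ (0 < i)%N, (i < m)%N & odd 'C(m, i)].
Proof.
move=> m0; have [o co e] := pfactor_coprime (isT : prime 2) m0.
set j := logn 2 m in e; have oo : odd o by rewrite -coprime2n.
have [o1|o1] := eqVneq o 1%N; first by left; exists j; rewrite e o1 mul1n.
right; exists (2 ^ j)%N; split; rewrite ?expn_gt0 //.
  by rewrite e -{1}(mul1n (2 ^ j)%N) ltn_pmul2r ?expn_gt0 //; case: o o1 oo {co e} => [|[]].
have ch2 : 2 \in [pchar {poly 'F_2}] by rewrite inE /= poly_F2_char2 eqxx.
have F2 : forall n, (n%:R == 0 :> 'F_2) = ~~ odd n.
  by move=> n; rewrite -(dvdn_pcharf (pchar_Fp (isT : prime 2))) dvdn2.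
suff h : 'C(m, 2 ^ j)%:R = o%:R :> 'F_2.
  by have := F2 'C(m, 2 ^ j); rewrite h F2 oo => /esym/negbFE.
have jm : (2 ^ j <= m)%N by rewrite e leq_pmull //; case: o oo {co e o1}.
rewrite -(coef_1pX _ jm) e mulnC exprM exprDn_pchar; last first.
  by rewrite (eq_pnat _ (pcharf_eq ch2)) pnatX pnat_id.
rewrite expr1n.
have -> : (1 + 'X^(2 ^ j)) ^+ o = ((1 + 'X) ^+ o) \Po 'X^(2 ^ j) :> {poly 'F_2}.
  by rewrite [RHS]rmorphXn rmorphD rmorph1 /= comp_polyX.
by rewrite coef_comp_poly_Xn ?expn_gt0 // dvdnn divnn expn_gt0 /= coef_1pX ?bin1 //; case: o oo {co e o1}.
Qed.

(** For 0 < i < m the coefficient of 'X^i in 'X^m + 1 + ('X + 1)^m is 'C(m, i). *)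
Lemma psum_neq0 m i : (0 < i)%N -> (i < m)%N -> odd 'C(m, i) -> psum 'X 1 m != 0 :> F2X.
Proof.
move=> i0 im oC; apply: contraTneq (oner_neq0 'F_2) => /(congr1 (fun p : F2X => p`_i)).
rewrite /psum expr1n coef0 !coefD coefXn ltn_eqF // coef1 gtn_eqF // !add0r addrC coef_1pX ?(ltnW im) //.
rewrite -(odd_double_half 'C(m, i)) oC natrD -mul2n natrM (_ : 2%:R = 0 :> 'F_2); last exact/val_inj.
by rewrite mul0r addr0 => /eqP.
Qed.

(** With f = m! = u 2^(m - s) this is u e_m = 2^(s - 2) h_m, cleared of denominators. *)
Lemma scale_hurwitz (R : comPzRingType) (U H : R) n u s m f : (1 < s)%N -> (1 < m)%N ->
  2 ^+ m.-2 * H = f%:R * U -> (f * 2 ^ s = u * 2 ^ m)%N ->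
  (2 ^ m)%:R * ((n * u)%:R * U) = (2 ^ m)%:R * ((2 ^ (s - 2))%:R * (n%:R * H)).
Proof.
move=> s2 m2 HU fu.
transitivity (n%:R * ((u * 2 ^ m)%:R * U)); first by rewrite !natrM; ring.
rewrite -fu natrM mulrAC -HU !natrX.
have -> : 2 ^+ m * (2 ^+ (s - 2) * (n%:R * H)) = n%:R * (2 ^+ (m + (s - 2)) * H) :> R by rewrite exprD; ring.
have -> : (m + (s - 2) = m.-2 + s)%N by lia.
by rewrite exprD; ring.
Qed.

Lemma wpU_val_general m i : (0 < i)%N -> (i < m)%N -> odd 'C(m, i) ->
  (2 <= binary_ones m)%N /\
  exists n P, [/\ odd n, n%:R * wpU m = (2 ^ (binary_ones m - 2))%:R * toQ P & red P != 0].
Proof.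
move=> i0 im oC.
have s2 : (2 <= binary_ones m)%N.
  rewrite (binary_ones_odd_bin (ltnW im) oC).
  by apply: (@leq_add 1 1); apply: binary_ones_gt0; rewrite ?subn_gt0.
split=> //; have [n [P [on nP Px]]] := reduces_wpH (ltn_trans i0 im).
have [u ou fu] := fact_binary_ones m.
exists (n * u)%N, P; split; rewrite ?oddM ?on ?Px ?(psum_neq0 i0 im oC) //.
have m2 : (2 <= m)%N by lia.
have HU := wpH_U m.
have two k : (2 ^ k)%:R != 0 :> Q2.
  by case E : (2 ^ k)%N (expn_gt0 2 k) => [|l] // _; exact: Q2_char0.
apply: (mulfI (two m)); rewrite -nP.
exact: (@scale_hurwitz Q2 (wpU m) (wpH m) n u (binary_ones m) m m`! s2 m2 HU fu).
Qed.

Lemma reduces_ex_sum I (r : seq I) (F : I -> Q2) : (forall i, exists x, reduces (F i) x) ->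
  exists x, reduces (\sum_(i <- r) F i) x.
Proof.
move=> h; apply: (big_ind (fun q => exists x, reduces q x)) => //.
- by exists 0; exact: (reduces_nat 0).
- by move=> q s [x hx] [y hy]; exists (x + y); exact: reducesD.
Qed.

Lemma sum_sym (F : nmodType) (f : nat -> F) l : (forall i, (i < l)%N -> f (l.*2 - i)%N = f i) ->
  \sum_(i < l.*2.+1) f i = (\sum_(i < l) f i) *+ 2 + f l.
Proof.
move=> fs; rewrite -[in LHS]addnn -addnS big_split_ord /= big_ord_recl /= addn0.
rewrite mulr2n -addrA [_ + f l]addrC; congr (_ + (_ + _)).
rewrite (reindex_inj rev_ord_inj) /=; apply: eq_bigr => i _.
rewrite -(fs i (ltn_ord i)); congr (f _); rewrite /bump /= -addnn; have := ltn_ord i; lia.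
Qed.

(** For m = 2 l the convolution in [wp_rec_ode] is e_l^2 plus twice a half sum, and 2 m + 1 and m -
    3 are odd. Integrality of the lower e_i makes the doubled half sum vanish modulo 2. *)
Lemma reduces_wpU_double l y : (1 < l)%N -> (forall i, (i < l.*2)%N -> exists x, reduces (wpU i) x) ->
  reduces (wpU l) y -> reduces (wpU l.*2) (y ^+ 2).
Proof.
move=> l1 IH hy.
apply: (@reduces_div (l.*2 - 3)); first by rewrite oddB ?odd_double //; lia.
apply: (@reduces_div (2 * l.*2 + 1)); first by rewrite oddD oddM.
have := wp_rec_ode Q2_char0 wpU0 wpU1 wpU_rec (_ : 1 < l.*2)%N.
rewrite gtn_eqF; last by lia.
rewrite mul0r mulr0 subr0 natrD natrM natrB; last by lia.
rewrite -mulrA => -> //; last by lia.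
rewrite (sum_sym (f := fun i => wpU i * wpU (l.*2 - i)%N)); last first.
  by move=> i il; rewrite subKn 1?mulrC //; lia.
have [x hx] : exists x, reduces (\sum_(i < l) wpU i * wpU (l.*2 - i)%N) x.
  apply: reduces_ex_sum => i; have il := ltn_ord i.
  have [->|i0] := posnP (nat_of_ord i); first by exists 0; rewrite mul0r; exact: (reduces_nat 0).
  have [|x hx] := IH i; first by lia.
  have [|x' hx'] := IH (l.*2 - i)%N; first by lia.
  by exists (x * x'); exact: reducesM.
rewrite (_ : l.*2 - l = l)%N; last by lia.
rewrite -[X in _ * (X + _)]mulr_natl.
have -> : y ^+ 2 = 3%:R * (2%:R * x + y * y) by rewrite poly_F2_char2 mul0r add0r (poly_F2_nat 3) mul1r expr2.
by apply: reducesM (reduces_nat 3) (reducesD (reducesM (reduces_nat 2) hx) (reducesM hy hy)).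
Qed.

Lemma binary_ones_pow2 j : binary_ones (2 ^ j) = 1%N.
Proof.
elim: j => [|j IH]; last by rewrite expnS mul2n binary_ones_double.
by rewrite /binary_ones big_ord_recl big_ord0.
Qed.

Lemma redA_neq0 : redA != 0.
Proof.
apply: contraTneq (oner_neq0 'F_2) => /(congr1 (fun p : F2X => p.[0])).
by rewrite /redA !hornerE /= => /eqP.
Qed.

(** One induction for both claims, because doubling needs every lower e_i to be integral. Away from
    powers of 2 integrality comes from [wpU_val_general]. *)
Lemma reduces_wpU m : (exists x, reduces (wpU m) x) /\
  (forall j, m = (2 ^ j.+1)%N -> reduces (wpU m) (redA ^+ (2 ^ j))).
Proof.
elim/ltn_ind: m => m IH; have [->|m0] := posnP m.
  split=> [|j /eqP]; first by exists 0; exact: (reduces_nat 0).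
  by rewrite eq_sym expn_eq0.
have [[j]|[i [i0 im oC]]] := two_power_or_odd_bin m0; last first.
  have [s2 [n [P [on nP _]]]] := wpU_val_general i0 im oC.
  split; last by move=> j mj; move: s2; rewrite mj binary_ones_pow2.
  exists (red ((2 ^ (binary_ones m - 2))%:R * P)), n, ((2 ^ (binary_ones m - 2))%:R * P).
  by split; rewrite // toQM toQ_nat.
case: j => [|j] mj.
  rewrite mj; split; first by exists 0; exact: (reduces_nat 0).
  by move=> j /eqP; rewrite eqn_exp2l.
case: j mj => [|j] mj.
  rewrite mj; suff h : reduces (wpU (2 ^ 1)) redA.
    by split=> [|j /eqP]; [exists redA|rewrite eqn_exp2l // => /eqP[<-]; rewrite expn0 expr1].
  exact: reducesX.
have mE : m = (2 ^ j.+1).*2 by rewrite mj expnS mul2n.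
have h : reduces (wpU m) (redA ^+ (2 ^ j.+1)).
  rewrite expnSr exprM mE; apply: reduces_wpU_double.
  - by rewrite (@ltn_exp2l 2 0 j.+1).
  - by move=> i im; have [] := IH i; rewrite ?mE.
  - by have [|_ hp] := IH (2 ^ j.+1)%N; [rewrite mj ltn_exp2l|exact: hp].
split=> [|j' mj']; first by exists (redA ^+ (2 ^ j.+1)).
have : (2 ^ j.+2 = 2 ^ j'.+1)%N by rewrite -mj.
by move/eqP; rewrite eqn_exp2l // => /eqP[<-].
Qed.

#[local] Existing Instance totally_filter.
Local Open Scope classical_set_scope.

(** * Unconditional sums *)

Definition has_sum (K : numFieldType) (I : choiceType) (x : I -> K) (s : K) :=
  partial_sum (x : I -> K^o) @ totally --> (s : K^o).

Section HasSum.
Variable K : numFieldType.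
Implicit Types I J : choiceType.

Lemma partial_sumE I (x : I -> K) (A : {fset I}) :
  partial_sum (x : I -> K^o) A = \sum_(i <- A) x i.
Proof. by rewrite /partial_sum big_seq_fsetE. Qed.

Lemma has_sumP I (x : I -> K) s :
  has_sum x s <-> forall e : K, 0 < e -> exists A : {fset I}, forall B : {fset I},
    (A `<=` B)%fset -> `|s - \sum_(i <- B) x i| < e.
Proof.
split.
  move=> h e e0; have [A _ hA] := (cvgrPdist_lt _ _).1 h e e0.
  by exists A => B AB; have := hA B AB; rewrite /= partial_sumE.
move=> h; apply/cvgrPdist_lt => e e0; have [A hA] := h e e0.
by exists A => //= B AB; rewrite partial_sumE; apply: hA.
Qed.

Lemma has_sum_unique I (x : I -> K) s t : has_sum x s -> has_sum x t -> s = t.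
Proof. by move=> hs ht; apply: (cvg_unique _ hs ht). Qed.

Lemma has_sum_eq I (x y : I -> K) s : x =1 y -> has_sum x s -> has_sum y s.
Proof. by move=> /funext ->. Qed.

Lemma has_sumD I (x y : I -> K) s t :
  has_sum x s -> has_sum y t -> has_sum (fun i => x i + y i) (s + t).
Proof.
move=> hx hy; rewrite /has_sum.
have -> : partial_sum ((fun i => x i + y i) : I -> K^o) =
   (partial_sum (x : I -> K^o) \+ partial_sum (y : I -> K^o)).
  by apply/funext => A /=; rewrite !partial_sumE big_split.
exact: cvgD.
Qed.

Lemma has_sumZ I (x : I -> K) s c :
  has_sum x s -> has_sum (fun i => c * x i) (c * s).
Proof.
move=> hx; rewrite /has_sum.
have -> : partial_sum ((fun i => c * x i) : I -> K^o) =
   (fun A => c *: (partial_sum (x : I -> K^o) A : K^o)).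
  by apply/funext => A /=; rewrite -[RHS]/(c * _) !partial_sumE mulr_sumr.
by apply: cvgZr.
Qed.

Lemma has_sum0 I : has_sum (fun _ : I => 0 : K) 0.
Proof. 
apply/has_sumP => e e0; exists fset0 => B _.
by rewrite big1 // subr0 normr0.
Qed.

Lemma has_sum_sum I T (r : seq T) (P : pred T) (x : T -> I -> K) (s : T -> K) :
  (forall t, P t -> has_sum (x t) (s t)) ->
  has_sum (fun i => \sum_(t <- r | P t) x t i) (\sum_(t <- r | P t) s t).
Proof.
move=> h; elim: r => [|t r IH].
  by rewrite big_nil; apply: has_sum_eq (has_sum0 I) => i; rewrite big_nil.
rewrite big_cons; case: ifP => Pt.
  by apply: has_sum_eq (has_sumD (h t Pt) IH) => i; rewrite big_cons Pt.
by apply: has_sum_eq IH => i; rewrite big_cons Pt.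
Qed.

Lemma big_fset_reindex I J (j : I -> J) (y : J -> K) (B : {fset J}) :
  injective j -> (forall l, (forall i, j i <> l) -> y l = 0) ->
  forall A : {fset I}, (forall i, (i \in A) = (j i \in B)) ->
  \sum_(l <- B) y l = \sum_(i <- A) y (j i).
Proof.
move=> inj y0 A hA.
have -> : \sum_(i <- A) y (j i) = \sum_(l <- (j @` A)%fset) y l.
  by rewrite big_imfset //= => ? ? _ _; apply: inj.
symmetry; apply: big_fset_incl.
  by apply/fsubsetP => l /imfsetP[i /= iA ->]; rewrite -hA.
move=> l lB lA; apply: y0 => i ji; move/negP: lA; apply.
by apply/imfsetP; exists i => //=; rewrite hA ji.
Qed.

Lemma has_sum_reindex I J (j : I -> J) (x : I -> K) (y : J -> K) s :
  injective j -> (forall i, y (j i) = x i) ->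
  (forall l, (forall i, j i <> l) -> y l = 0) ->
  has_sum x s -> has_sum y s.
Proof.
move=> inj yx y0 /has_sumP h; apply/has_sumP => e e0.
have [A hA] := h e e0; exists (j @` A)%fset => B AB.
(* A partial inverse of j, which pulls the finite set B back to a finite subset of I. *)
pose pre (l : J) : option I := if pselect (exists i, j i = l) is left ex then Some (projT1 (cid ex)) else None.
have preK i : pre (j i) = Some i.
  rewrite /pre; case: pselect => [ex|[]]; last by exists i.
  by congr Some; apply: inj; case: (cid ex).
pose A' := [fset i in pmap pre (enum_fset B)]%fset.
have A'E i : (i \in A') = (j i \in B).
  rewrite !inE mem_pmap; apply/mapP/idP => [[l lB]|jB].
    rewrite /pre; case: pselect => // ex [->]; case: (cid ex) => i' /= ->; exact: lB.
  by exists (j i) => //; rewrite preK.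
rewrite (big_fset_reindex inj y0 A'E) (eq_bigr x) //; apply: hA.
apply/fsubsetP => i iA; rewrite A'E; apply: (fsubsetP AB).
by apply/imfsetP; exists i.
Qed.

Definition bounded_sums I (b : I -> K) (M : K) :=
  forall A : {fset I}, \sum_(i <- A) b i <= M.

Lemma has_sum_le I (x : I -> K) (b : I -> K) s M :
  (forall i, `|x i| <= b i) -> bounded_sums b M -> has_sum x s -> `|s| <= M.
Proof.
move=> xb bM /has_sumP h.
have M0 : 0 <= M by have := bM fset0; rewrite big_seq_fset0.
suff: forall e, 0 < e -> `|s| <= M + e by move/ler_addgt0Pr.
move=> e e0; have [A /(_ A (fsubset_refl _)) hA] := h e e0.
rewrite -[s](subrK (\sum_(i <- A) x i)) addrC.
apply: le_trans (ler_normD _ _) _; apply: lerD; last exact: ltW.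
by apply: le_trans (ler_norm_sum _ _ _) _; apply: le_trans (bM A); apply: ler_sum.
Qed.

End HasSum.

Arguments has_sumZ {K I x s} c _.

Lemma ler_sum_fsubset (R : numDomainType) (I : choiceType) (x : I -> R) (A B : {fset I}) :
  (forall i, 0 <= x i) -> (A `<=` B)%fset -> \sum_(i <- A) x i <= \sum_(i <- B) x i.
Proof.
move=> x0 AB; rewrite [leRHS](big_fsetID _ (mem A)) /=.
have -> : [fset i in B | i \in A]%fset = A.
  by apply/fsetP => i; rewrite !inE /= andbC; case: (boolP (i \in A)) => //= /(fsubsetP AB).
by rewrite lerDl; apply: sumr_ge0 => i _; exact: x0.
Qed.

Lemma has_sum_nneg (R : realType) (I : choiceType) (x : I -> R) M :
  (forall i, 0 <= x i) -> bounded_sums x M -> exists s, has_sum x s.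
Proof.
move=> x0 xM.
pose S := [set r : R | exists A : {fset I}, r = \sum_(i <- A) x i].
have supS : has_sup S.
  split; first by exists (\sum_(i <- fset0) x i); exists fset0.
  by exists M => _ [A ->]; exact: xM.
exists (sup S); apply/has_sumP => e e0.
have [_ [A ->] hA] := sup_adherent e0 supS.
exists A => B AB.
have BS : \sum_(i <- B) x i <= sup S by apply: (ub_le_sup supS.2); exists B.
rewrite ger0_norm ?subr_ge0 //.
have := ler_sum_fsubset x0 AB; lra.
Qed.

Local Open Scope complex_scope.

Section ComplexSums.
Variable R : realType.
Implicit Types I J : choiceType.

Lemma has_sum_real_complex I (x : I -> R) s :
  has_sum x s -> has_sum (fun i => (x i)%:C) (s%:C).
Proof.
move=> /has_sumP h; apply/has_sumP => e; rewrite ltcE /= => /andP[/eqP e0 e1].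
have [A hA] := h _ e1; exists A => B /hA; rewrite -rmorph_sum -rmorphB /=.
by rewrite normc_def /= expr0n addr0 sqrtr_sqr ltcE /= e0 eqxx.
Qed.

Lemma normc_ge_Im (z : R[i]) : (`|complex.Im z|%:C <= `|z|)%C.
Proof.
by rewrite normc_def lecR -sqrtr_sqr; apply: ler_wsqrtr; rewrite lerDr sqr_ge0.
Qed.

Lemma bounded_sumsD I (b c : I -> R) M N :
  bounded_sums b M -> bounded_sums c N -> bounded_sums (fun i => b i + c i) (M + N).
Proof. by move=> hb hc A; rewrite big_split; apply: lerD. Qed.

(** For real y the family y + b is nonnegative with bounded sums, and so is b; y is their
    difference. Complex families are split into real and imaginary parts. *)
Lemma has_sum_abs I (x : I -> R[i]) (b : I -> R) M :
  (forall i, `|x i| <= (b i)%:C) -> bounded_sums b M -> exists s, has_sum x s.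
Proof.
move=> xb bM.
have key (y : I -> R) : (forall i, `|y i| <= b i) -> exists s, has_sum y s.
  move=> yb.
  have b0 i : 0 <= b i by apply: le_trans (yb i).
  have [t ht] := has_sum_nneg b0 bM.
  have yb0 i : 0 <= y i + b i by have := yb i; rewrite ler_norml => /andP[]; lra.
  have [|s hs] := @has_sum_nneg _ _ _ (M + M) yb0.
    move=> A; apply: le_trans (bounded_sumsD bM bM A); apply: ler_sum => i _.
    by have := yb i; rewrite ler_norml => /andP[]; lra.
  exists (s + (-1) * t).
  by refine (has_sum_eq _ (has_sumD hs (has_sumZ (-1) ht))) => i; rewrite mulN1r addrK.
have [i|s hs] := key (fun i => complex.Re (x i)).
  by rewrite -lecR; apply: le_trans (xb i); exact: normc_ge_Re.
have [i|t ht] := key (fun i => complex.Im (x i)).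
  by rewrite -lecR; apply: le_trans (xb i); exact: normc_ge_Im.
exists (s%:C + 'i * t%:C).
apply: has_sum_eq (has_sumD (has_sum_real_complex hs) (has_sumZ _ (has_sum_real_complex ht))).
by move=> i; rewrite -complexE.
Qed.

Lemma bounded_sums_prod I J (b : I -> R) (c : J -> R) M N :
  (forall i, 0 <= b i) -> (forall j, 0 <= c j) ->
  bounded_sums b M -> bounded_sums c N ->
  bounded_sums (fun p : I * J => b p.1 * c p.2) (M * N).
Proof.
move=> b0 c0 bM cN A.
pose A1 := [fset p.1 | p in A]%fset; pose A2 := [fset p.2 | p in A]%fset.
have AA : (A `<=` A1 `*` A2)%fset.
  apply/fsubsetP => p pA; rewrite in_fsetM; apply/andP.
  by split; apply/imfsetP; exists p.
apply: le_trans (ler_sum_fsubset _ AA) _.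
  by move=> p; apply: mulr_ge0.
rewrite big_imfset2 /=; last by move=> [? ?] [? ?] _ _ /= [-> ->].
have -> : \sum_(i <- A1) \sum_(j <- A2) b i * c j = (\sum_(i <- A1) b i) * \sum_(j <- A2) c j.
  by rewrite mulr_suml; apply: eq_bigr => i _; rewrite mulr_sumr.
by apply: ler_pM => //; apply: sumr_ge0 => i _.
Qed.

(** Absolute convergence gives some sum r. Finite rectangles, over which the sum factors, contain
    every finite set of pairs and identify r with s t. *)
Lemma has_sum_prod I J (x : I -> R[i]) (y : J -> R[i]) (b : I -> R) (c : J -> R) M N s t :
  (forall i, `|x i| <= (b i)%:C) -> (forall j, `|y j| <= (c j)%:C) ->
  bounded_sums b M -> bounded_sums c N -> has_sum x s -> has_sum y t ->
  has_sum (fun p : I * J => x p.1 * y p.2) (s * t).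
Proof.
move=> xb yc bM cN hx hy.
have b0 i : 0 <= b i by rewrite -ler0c; exact: le_trans (normr_ge0 _) (xb i).
have c0 i : 0 <= c i by rewrite -ler0c; exact: le_trans (normr_ge0 _) (yc i).
have [|r hr] := has_sum_abs (x := fun p : I * J => x p.1 * y p.2) _ (bounded_sums_prod b0 c0 bM cN).
  by move=> p; rewrite normrM rmorphM ler_pM.
suff -> : s * t = r by [].
apply/esym/eqP; rewrite -subr_eq0 -normr_le0; apply/ler_addgt0Pr => e e0; rewrite add0r.
(* The three errors will be at most e / D, M e / D and |t| e / D. *)
pose D := 1 + M%:C + `|t|.
have M0 : 0 <= M%:C :> R[i] by rewrite lecR; have := bM fset0; rewrite big_seq_fset0.
have D0 : 0 < D by rewrite /D -addrA ltr_pwDl // addr_ge0.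
have d0 : 0 < e / D by rewrite divr_gt0.
have [A hA] := (has_sumP _ _).1 hr _ d0.
have [A1 hA1] := (has_sumP _ _).1 hx _ d0.
have [A2 hA2] := (has_sumP _ _).1 hy _ d0.
pose B1 := (A1 `|` [fset p.1 | p in A])%fset; pose B2 := (A2 `|` [fset p.2 | p in A])%fset.
have /hA1 h1 : (A1 `<=` B1)%fset by exact: fsubsetUl.
have /hA2 h2 : (A2 `<=` B2)%fset by exact: fsubsetUl.
have /hA h : (A `<=` B1 `*` B2)%fset.
  apply/fsubsetP => p pA; rewrite in_fsetM !in_fsetU; apply/andP.
  by split; apply/orP; right; apply/imfsetP; exists p.
move: h; rewrite big_imfset2 /=; last by move=> [? ?] [? ?] _ _ /= [-> ->].
have -> : \sum_(i <- B1) \sum_(j <- B2) x i * y j = (\sum_(i <- B1) x i) * \sum_(j <- B2) y j.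
  by rewrite mulr_suml; apply: eq_bigr => i _; rewrite mulr_sumr.
have xM : `|\sum_(i <- B1) x i| <= M%:C.
  apply: le_trans (ler_norm_sum _ _ _) _.
  apply: (@le_trans _ _ (\sum_(i <- B1) (b i)%:C)); first exact: ler_sum.
  by rewrite -rmorph_sum lecR.
move: (\sum_(i <- B1) x i) (\sum_(j <- B2) y j) h1 h2 xM => X Y h1 h2 xM h.
have -> : r - s * t = (r - X * Y) + (- X * (t - Y) - (s - X) * t) by ring.
have -> : e = e / D + (M%:C * (e / D) + (e / D) * `|t|).
  by rewrite /D; field; rewrite -/D gt_eqF.
apply: le_trans (ler_normD _ _) _; apply: lerD; first exact: ltW.
apply: le_trans (ler_normB _ _) _; rewrite !normrM normrN.
by apply: lerD; rewrite ler_pM // ltW.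
Qed.

End ComplexSums.

(** * Sums over a lattice *)

Section Lattice.
Variable R : realType.

(** The exponent 3/2 arises when the third power of a lattice point is shared equally between its
    two coordinates, and it is still summable. *)
Definition dom_nat (n : nat) : R := (n.+1%:R * Num.sqrt n.+1%:R)^-1.

Lemma dom_nat_gt0 n : 0 < dom_nat n.
Proof. by rewrite invr_gt0 mulr_gt0 ?sqrtr_gt0 ?ltr0n. Qed.

(** The bound comes from the integral of x^(-3/2) and telescopes. *)
Lemma sum_dom_nat n : \sum_(i < n.+1) dom_nat i <= 3 - 2 / Num.sqrt n.+1%:R.
Proof.
elim: n => [|n IH]; first by rewrite big_ord_recr big_ord0 /= /dom_nat sqrtr1 !mulr1 invr1; lra.
rewrite big_ord_recr /=; apply: le_trans (lerD IH (lexx _)) _.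
rewrite /dom_nat; set a := Num.sqrt n.+1%:R; set b := Num.sqrt n.+2%:R.
have a0 : 0 < a by rewrite sqrtr_gt0 ltr0n.
have b0 : 0 < b by rewrite sqrtr_gt0 ltr0n.
have a2 : a ^+ 2 = n.+1%:R by rewrite sqr_sqrtr ?ler0n.
have b2 : b ^+ 2 = n.+2%:R by rewrite sqr_sqrtr ?ler0n.
have ab : a <= b by apply: ler_wsqrtr; rewrite ler_nat.
have d : b ^+ 2 = a ^+ 2 + 1 by rewrite a2 b2 -natr1.
rewrite -b2.
suff : (b ^+ 2 * b)^-1 <= 2 / a - 2 / b by lra.
have -> : 2 / a - 2 / b = 2 / (a * b * (a + b)).
  apply/eqP; rewrite eq_sym -subr_eq0; apply/eqP.
  have -> : 2 / (a * b * (a + b)) - (2 / a - 2 / b) = 2 * (1 - (b ^+ 2 - a ^+ 2)) / (a * b * (a + b)).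
    by field; rewrite !gt_eqF // addr_gt0.
  by rewrite d; ring.
rewrite -[leLHS]mul1r ler_pdivrMr ?mulr_gt0 // mulrAC ler_pdivlMr ?mulr_gt0 ?addr_gt0 //.
nra.
Qed.

Lemma bounded_sums_dom_nat : bounded_sums dom_nat 3.
Proof.
move=> A; pose n := \max_(i <- A) i.
apply: (@le_trans _ _ (\sum_(i <- [fset nat_of_ord i | i in 'I_n.+1]%fset) dom_nat i)).
  apply: ler_sum_fsubset => [i|]; first exact/ltW/dom_nat_gt0.
  apply/fsubsetP => i iA.
  have ni : (i < n.+1)%N by rewrite ltnS /n (big_fsetD1 i) //= leq_maxl.
  by apply/imfsetP; exists (Ordinal ni).
rewrite big_imfset /=; last by move=> i j _ _ /val_inj.
rewrite big_enum /=; apply: le_trans (sum_dom_nat n) _.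
by rewrite lerBlDr lerDl divr_ge0 // sqrtr_ge0.
Qed.

Lemma bounded_sums_inj (I J : choiceType) (j : I -> J) (c : J -> R) M :
  {in setT &, injective j} -> bounded_sums c M -> bounded_sums (fun i => c (j i)) M.
Proof.
move=> inj cM A; have := cM [fset j i | i in A]%fset.
by rewrite big_imfset //= => i i' _ _; apply: inj; rewrite inE.
Qed.

Lemma bounded_sums_dom_int : bounded_sums (fun n : int => dom_nat `|n|%N) 6.
Proof.
move=> A; rewrite (big_fsetID _ (fun n : int => 0 <= n)) /=.
have half (P : pred int) : {in P &, injective absz} ->
    \sum_(i <- [fset x in A | P x]%fset) dom_nat `|i|%N <= 3.
  move=> inj; have := bounded_sums_dom_nat [fset absz i | i in [fset x in A | P x]]%fset.
  rewrite big_imfset //= => i j; rewrite !inE /= => /andP[_ iP] /andP[_ jP].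
  exact: inj.
have -> : 6 = 3 + 3 :> R by rewrite -natrD.
by apply: lerD; apply: half => i j; rewrite !unfold_in; lia.
Qed.

Definition dom (p : int * int) : R := dom_nat `|p.1|%N * dom_nat `|p.2|%N.

Lemma dom_gt0 p : 0 < dom p.
Proof. by rewrite mulr_gt0 ?dom_nat_gt0. Qed.

Lemma bounded_sums_dom : bounded_sums dom 36.
Proof.
have -> : 36 = 6 * 6 :> R by rewrite -natrM.
apply: (@bounded_sums_prod _ _ _ (fun n : int => dom_nat `|n|%N) (fun n : int => dom_nat `|n|%N));
  by [move=> i; exact/ltW/dom_nat_gt0|exact: bounded_sums_dom_int].
Qed.

Definition domq (p : int * int) : R := (`|p.1|%N.+1 * `|p.2|%N.+1)%:R.

Lemma domq_ge1 p : 1 <= domq p.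
Proof. by rewrite ler1n muln_gt0. Qed.

Lemma domE p : dom p = (Num.sqrt (domq p) ^+ 3)^-1.
Proof.
rewrite /dom /dom_nat /domq natrM sqrtrM ?ler0n //.
rewrite -invfM; congr (_^-1).
have := @sqr_sqrtr R (`|p.1|%N.+1)%:R (ler0n _ _).
have := @sqr_sqrtr R (`|p.2|%N.+1)%:R (ler0n _ _).
by move: (Num.sqrt _) (Num.sqrt _) => b a <- <-; ring.
Qed.

Lemma domq_le p : p != 0 -> domq p <= 4 * (p.1%:~R ^+ 2 + p.2%:~R ^+ 2).
Proof.
case: p => m n; rewrite -pair_eqE /= negb_and => mn0.
rewrite /domq /= -!rmorphXn /= -rmorphD /=.
have -> : 4 = 4%:~R :> R by [].
rewrite -rmorphM /= -[(_ * _)%:R]/((Posz (`|m|.+1 * `|n|.+1))%:~R) ler_int.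
have sqr_abs (i : int) : i ^+ 2 = (`|i|%N ^ 2)%N.
  by rewrite -abszX abszE ger0_norm ?sqr_ge0.
rewrite !sqr_abs.
have : (0 < `|m|%N + `|n|%N)%N by lia.
move: `|m|%N `|n|%N => a b ab.
rewrite -PoszD -[4]/(Posz 4) -PoszM lez_nat.
rewrite -!mulnn.
have [a0|a0] := posnP a; last have [b0|b0] := posnP b; subst; nia.
Qed.

Definition omega (z : R[i]) (p : int * int) : R[i] := p.1%:~R * z + p.2%:~R.

Lemma omega0 z : omega z 0 = 0.
Proof. by rewrite /omega /= mul0r addr0. Qed.

Lemma omegaB z p q : omega z (p - q) = omega z p - omega z q.
Proof. by rewrite /omega /= !rmorphB /=; ring. Qed.

Lemma sqr_normc_omega z p : Normc.normc (omega z p) ^+ 2 =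
  (p.1%:~R * complex.Re z + p.2%:~R) ^+ 2 + (p.1%:~R * complex.Im z) ^+ 2.
Proof.
case: z => x y; rewrite /omega /=.
have cint (m : int) : m%:~R = (m%:~R : R)%:C by rewrite rmorph_int.
rewrite !cint /= !mul0r !(subr0, addr0, add0r) sqr_sqrtr //.
by rewrite addr_ge0 ?sqr_ge0.
Qed.

(** The lower bound is a product over the two coordinates, so the lattice sums are dominated by a
    product of two simple series. *)
Lemma omega_ge z : 0 < complex.Im z -> exists2 c : R, 0 < c &
  forall p, p != 0 -> c * Num.sqrt (domq p) <= Normc.normc (omega z p).
Proof.
set x := complex.Re z; set y := complex.Im z => y0.
(* From n^2 <= 2 (m x + n)^2 + 2 x^2 m^2 and m^2 = (m y)^2 / y^2; the 4 is that of [domq_le]. *)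
pose D := 4 * (2 + (2 * x ^+ 2 + 1) / y ^+ 2).
have y2 : 0 < y ^+ 2 by rewrite exprn_gt0.
have D0 : 0 < D.
  rewrite mulr_gt0 // ltr_wpDr // divr_ge0 ?ltW //; have := sqr_ge0 x; lra.
exists (Num.sqrt D)^-1; first by rewrite invr_gt0 sqrtr_gt0.
move=> p p0; rewrite ler_pdivrMl ?sqrtr_gt0 //.
have n0 : 0 <= Normc.normc (omega z p) by rewrite -ler0c; exact: (normr_ge0 (omega z p)).
rewrite -[Normc.normc _]ger0_norm // -sqrtr_sqr -sqrtrM; last exact: ltW.
apply: ler_wsqrtr.
apply: le_trans (domq_le p0) _; rewrite sqr_normc_omega -/x -/y.
move: (p.1%:~R : R) (p.2%:~R : R) => m n.
rewrite /D -mulrA ler_pM2l //.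
have -> : (2 + (2 * x ^+ 2 + 1) / y ^+ 2) * ((m * x + n) ^+ 2 + (m * y) ^+ 2) =
  2 * (m * x + n) ^+ 2 + (2 * x ^+ 2 + 1) / y ^+ 2 * (m * x + n) ^+ 2 + 2 * (m * y) ^+ 2 + (2 * x ^+ 2 + 1) * m ^+ 2.
  by field; rewrite gt_eqF.
have h1 : 0 <= (2 * x ^+ 2 + 1) / y ^+ 2 * (m * x + n) ^+ 2.
  by rewrite mulr_ge0 ?sqr_ge0 // divr_ge0 ?ltW //; have := sqr_ge0 x; lra.
have h2 := sqr_ge0 (m * y).
suff : n ^+ 2 <= 2 * (m * x + n) ^+ 2 + 2 * x ^+ 2 * m ^+ 2 by lra.
have := sqr_ge0 (2 * m * x + n); nra.
Qed.

Lemma omega_neq0 z p : 0 < complex.Im z -> p != 0 -> omega z p != 0.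
Proof.
move=> /omega_ge[c c0 h] /h; apply: contraTneq => ->; rewrite -ltNge Normc.normc0 mulr_gt0 //.
by rewrite sqrtr_gt0; apply: lt_le_trans (domq_ge1 p).
Qed.

Lemma omega_inv_le z (c : R) k p : 0 < c -> (2 < k)%N ->
  c * Num.sqrt (domq p) <= Normc.normc (omega z p) ->
  `|omega z p ^- k| <= (c ^- k * dom p)%:C.
Proof.
move=> c0 k2 cp; rewrite normrV ?normrX; last first.
  rewrite unitfE expf_neq0 //; apply: contraTneq cp => ->.
  rewrite -ltNge Normc.normc0 mulr_gt0 // sqrtr_gt0; exact: lt_le_trans (domq_ge1 p).
have q1 : 1 <= Num.sqrt (domq p) by rewrite -sqrtr1; apply/ler_wsqrtr/domq_ge1.
have q0 : 0 < Num.sqrt (domq p) by apply: lt_le_trans q1.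
rewrite domE -[X in X ^- k]/((Normc.normc (omega z p))%:C) -rmorphXn -fmorphV lecR -invfM.
rewrite lef_pV2 ?posrE; last 2 first.
- by rewrite exprn_gt0 //; apply: lt_le_trans cp; rewrite mulr_gt0.
- by rewrite mulr_gt0 ?exprn_gt0.
apply: (@le_trans _ _ ((c * Num.sqrt (domq p)) ^+ k)); last first.
  by rewrite lerXn2r ?nnegrE //; [rewrite ltW ?mulr_gt0|rewrite -ler0c; exact: (normr_ge0 (omega z p))].
by rewrite exprMn ler_pM2l ?exprn_gt0 // ler_weXn2l.
Qed.

Lemma omega_dom z k : 0 < complex.Im z -> (2 < k)%N ->
  exists c : R, forall p, `|omega z p ^- k| <= (c * dom p)%:C.
Proof.
move=> /omega_ge[c c0 h] k2; exists (c ^- k) => p; have [->|p0] := eqVneq p 0.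
  rewrite omega0 expr0n gtn_eqF ?(ltn_trans _ k2) //= invr0 normr0 ler0c.
  by rewrite mulr_ge0 ?invr_ge0 ?exprn_ge0 ?ltW ?dom_gt0.
exact: omega_inv_le (h p p0).
Qed.

Lemma bounded_sumsZ (I : choiceType) (b : I -> R) M c : 0 <= c ->
  bounded_sums b M -> bounded_sums (fun i => c * b i) (c * M).
Proof. by move=> c0 bM A; rewrite -mulr_sumr ler_wpM2l. Qed.

(** The origin may stay in the index set: for k > 0 its term 0 ^- k is 0. *)
Definition latticeG (k : nat) (z : R[i]) : R[i] :=
  sum (fun p : int * int => (omega z p ^- k : R[i]^o)).

Lemma has_sum_sumE (I : choiceType) (x : I -> R[i]) s :
  has_sum x s -> sum (x : I -> R[i]^o) = s.
Proof. by move=> h; apply: cvg_lim h; exact: norm_hausdorff. Qed.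

Lemma domc_ge0 (c : R) z k : (forall p, `|omega z p ^- k| <= (c * dom p)%:C) -> 0 <= c.
Proof.
move=> h; rewrite -(pmulr_lge0 _ (dom_gt0 0)) -ler0c.
exact: le_trans (normr_ge0 _) (h 0).
Qed.

Lemma has_sum_latticeG k z : 0 < complex.Im z -> (2 < k)%N ->
  has_sum (fun p => omega z p ^- k) (latticeG k z).
Proof.
move=> z0 k2; have [c hc] := omega_dom z0 k2.
have [s hs] := has_sum_abs hc (bounded_sumsZ (domc_ge0 hc) bounded_sums_dom).
by rewrite /latticeG (has_sum_sumE hs).
Qed.

End Lattice.

(** * Eisenstein series as lattice sums *)

Section Eisenstein.
Variable R : realType.

Lemma natV_le_dom k n : (2 < k)%N -> (n.+1%:R ^- k : R) <= dom_nat R n.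
Proof.
move=> k2; have n0 : 0 < n.+1%:R :> R by rewrite ltr0n.
have n1 : 1 <= n.+1%:R :> R by rewrite ler1n.
rewrite /dom_nat lef_pV2 ?posrE ?exprn_gt0 ?mulr_gt0 ?sqrtr_gt0 //.
apply: (@le_trans _ _ (n.+1%:R ^+ 2)); last exact/ler_weXn2l/ltnW.
rewrite expr2 ler_pM2l //; apply: (@le_trans _ _ (Num.sqrt (n.+1%:R ^+ 2))).
  by apply: ler_wsqrtr; rewrite expr2 ler_peMl // ltW.
by rewrite sqrtr_sqr ger0_norm // ltW.
Qed.

Lemma has_sum_zeta k : (2 < k)%N -> has_sum (fun n => n.+1%:R ^- k : R) (zeta R k).
Proof.
move=> k2; have [||s hs] := @has_sum_nneg R nat (fun n => n.+1%:R ^- k) 3.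
- by move=> n; rewrite invr_ge0 exprn_ge0.
- move=> A; apply: le_trans (@bounded_sums_dom_nat R A).
  by apply: ler_sum => n _; exact: natV_le_dom.
suff -> : zeta R k = s by [].
apply: cvg_lim => //; apply/cvgrPdist_lt => e e0.
have [A hA] := (has_sumP _ _).1 hs _ e0.
exists (\max_(i <- A) i).+1 => // n /= An.
rewrite /series /= (_ : \sum_(0 <= i < n) _ = \sum_(i <- [fset nat_of_ord i | i in 'I_n]%fset) i.+1%:R ^- k).
  apply: hA; apply/fsubsetP => i iA.
  have ni : (i < n)%N.
    by apply: leq_trans An; rewrite ltnS (big_fsetD1 i) //= leq_maxl.
  by apply/imfsetP; exists (Ordinal ni).
rewrite big_imfset /=; last by move=> i j _ _ /val_inj.
by rewrite big_enum big_mkord.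
Qed.

Let scale (x : nat * {p : int * int | coprimez p.1 p.2}) : int * int :=
  ((x.1.+1)%:Z * (val x.2).1, (x.1.+1)%:Z * (val x.2).2).

Lemma scale_inj : injective scale.
Proof.
move=> [n [[a b] ab]] [m [[c d] cd]]; rewrite /scale /= => -[e1 e2].
have nm : n = m.
  have : gcdz (n.+1%:Z * a) (n.+1%:Z * b) = gcdz (m.+1%:Z * c) (m.+1%:Z * d) by rewrite e1 e2.
  rewrite -!mulz_gcdr /=; move: ab cd; rewrite /coprimez => /eqP -> /eqP ->; lia.
rewrite nm in e1 e2 *; congr (_, _); apply: val_inj => /=.
by congr (_, _); [apply: (mulfI _ e1)|apply: (mulfI _ e2)].
Qed.

(** Every nonzero pair is uniquely a positive integer, its gcd, times a coprime pair. So zeta(k)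
    times the sum over coprime pairs is a double series reindexed by [scale], which misses only the
    origin. *)
Lemma eisensteinG_lattice k (z : R[i]) : 0 < complex.Im z -> (2 < k)%N ->
  eisensteinG k z = latticeG k z.
Proof.
move=> z0 k2; have [c hc] := omega_dom z0 k2; have c0 := domc_ge0 hc.
pose xp (p : {p : int * int | coprimez p.1 p.2}) := omega z (val p) ^- k.
pose bp (p : {p : int * int | coprimez p.1 p.2}) := c * dom R (val p).
have xb p : `|xp p| <= (bp p)%:C by exact: hc.
have bM : bounded_sums bp (c * 36).
  apply: bounded_sumsZ c0 _.
  apply: (@bounded_sums_inj R _ _ _ (dom R)) (bounded_sums_dom R).
  by move=> p q _ _ /val_inj.
have [s hs] := has_sum_abs xb bM.
have -> : eisensteinG k z = (zeta R k)%:C * s.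
  rewrite /eisensteinG /eisensteinE.
  have -> : sum (fun p : {p : int * int | coprimez p.1 p.2} =>
    ((val p).1%:~R * z + (val p).2%:~R) ^- k : R[i]^o) = s by exact: (has_sum_sumE hs).
  by field.
have hprod := has_sum_prod (b := dom_nat R) (M := 3)
  (x := fun n => (n.+1%:R ^- k : R)%:C) _ xb (bounded_sums_dom_nat R) bM
  (has_sum_real_complex (has_sum_zeta k2)) hs.
apply: (has_sum_unique (x := fun p => omega z p ^- k)); last exact: has_sum_latticeG.
apply: (has_sum_reindex scale_inj _ _ (hprod _)).
- move=> [n [p cp]]; rewrite /scale /xp /= fmorphV rmorphXn rmorph_nat -invfM -exprMn.
  by congr (_ ^+ _)^-1; rewrite /omega /= !rmorphM /=; ring.
- move=> l hl; suff -> : l = 0 by rewrite omega0 expr0n gtn_eqF ?invr0 // (ltn_trans _ k2).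
  case: l hl => a b hl; apply/eqP; apply: contraT => ab0.
  have g0 : gcdz a b != 0 by rewrite gcdz_eq0; move: ab0; rewrite -pair_eqE.
  have gE : gcdz a b = (`|gcdz a b|.-1.+1)%N%:Z by rewrite prednK ?absz_gt0 // gez0_abs.
  have cp : coprimez (a %/ gcdz a b)%Z (b %/ gcdz a b)%Z.
    rewrite /coprimez; apply/eqP/(mulfI g0).
    rewrite mulr1 -[X in X * _](gez0_abs (_ : 0 <= gcdz a b)) //.
    by rewrite mulz_gcdr ![gcdz a b * _]mulrC !divzK ?dvdz_gcdl ?dvdz_gcdr.
  exfalso; apply: (hl (`|gcdz a b|.-1, exist _ (_, _) cp)).
  by rewrite /scale /= -gE ![gcdz a b * _]mulrC !divzK ?dvdz_gcdl ?dvdz_gcdr.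
- move=> n; rewrite ger0_norm ?ler0c ?invr_ge0 ?exprn_ge0 // lecR; exact: natV_le_dom.
Qed.

End Eisenstein.

(** * The recursion for lattice sums *)

(* [mbin a n] is the coefficient of [s ^ n] in [(1 - s) ^- a]. *)
Definition mbin (a n : nat) : nat := if a is a'.+1 then 'C(n + a', a') else (n == 0)%N.

Lemma mbinS a n : mbin a.+1 n.+1 = (mbin a.+1 n + mbin a n.+1)%N.
Proof.
case: a => [|a] /=; first by rewrite !bin0.
by rewrite addSn binS addSnnS.
Qed.

Lemma mbin0 a : mbin a 0 = 1%N.
Proof. by case: a => //= a; rewrite add0n binn. Qed.

Lemma mbin_conv a b n :
  (\sum_(i < n.+1) mbin a i * mbin b (n - i))%N = mbin (a + b) n.
Proof.
elim: a n => [|a IHa] n.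
  rewrite big_ord_recl big1 ?addn0 /= ?mul1n ?subn0 ?add0n // => i _.
elim: n => [|n IHn]; first by rewrite big_ord_recl big_ord0 !mbin0.
rewrite big_ord_recl mbin0 addSn mbinS -[(a + b).+1%N]addSn -IHn -IHa.
rewrite [X in _ = (_ + X)%N]big_ord_recl mbin0 addnCA; congr (_ + _)%N.
rewrite -big_split /=; apply: eq_bigr => i _.
by rewrite subSS -mulnDl -mbinS.
Qed.

Section PartialFractions.
Variable F : comPzRingType.
Implicit Types x y : F.

(** The coefficient of s^n in (1 - x s)^-a (1 - y s)^-b. *)
Definition pfrac x y a b n : F :=
  \sum_(i < n.+1) (mbin a i)%:R * (mbin b (n - i))%:R * x ^+ i * y ^+ (n - i).

Lemma pfracC x y a b n : pfrac x y a b n = pfrac y x b a n.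
Proof.
rewrite /pfrac (reindex_inj rev_ord_inj) /=; apply: eq_bigr => i _.
by rewrite subSS subKn -1?ltnS //; ring.
Qed.

Lemma pfracS x y a b n :
  pfrac x y a.+1 b n.+1 = x * pfrac x y a.+1 b n + pfrac x y a b n.+1.
Proof.
rewrite /pfrac [LHS]big_ord_recl [X in _ = _ + X]big_ord_recl !mbin0 [RHS]addrCA; congr (_ + _).
rewrite mulr_sumr -big_split /=; apply: eq_bigr => i _.
rewrite /bump /= add1n subSS -['C(i.+1 + a, a)]/(mbin a.+1 i.+1) mbinS natrD exprS; ring.
Qed.

(** This is (y - x) s = (1 - x s) - (1 - y s), read on coefficients. *)
Lemma pfrac_sub x y a b n : (y - x) * pfrac x y a.+1 b.+1 n =
  pfrac x y a b.+1 n.+1 - pfrac x y a.+1 b n.+1.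
Proof.
have h1 := pfracS x y a b.+1 n.
have h2 := pfracS y x b a.+1 n.
rewrite ![pfrac y x _ _ _]pfracC in h2.
have -> : pfrac x y a b.+1 n.+1 = pfrac x y a.+1 b.+1 n.+1 - x * pfrac x y a.+1 b.+1 n.
  by rewrite h1 addrAC subrr add0r.
by rewrite h2; ring.
Qed.

Lemma pfrac0l x y b n : pfrac x y 0 b n = (mbin b n)%:R * y ^+ n.
Proof.
rewrite /pfrac big_ord_recl big1 => [|i _]; first by rewrite subn0 /=; ring.
by rewrite /= !mul0r.
Qed.

Lemma pfrac0r x y a n : pfrac x y a 0 n = (mbin a n)%:R * x ^+ n.
Proof. by rewrite pfracC pfrac0l. Qed.

(** [pfrac_sub] is iterated until an exponent reaches 0; each round uses one of the five factors y -
    x. *)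
Lemma pfrac33 x y n : (y - x) ^+ 5 * pfrac x y 3 3 n =
  'C(n.+2, 2)%:R * (y ^+ n.+3 - x ^+ n.+3) * (y - x) ^+ 2
  - 3 * n.+1%:R * x * y * (x ^+ n.+2 + y ^+ n.+2) * (y - x)
  + 6 * x ^+ 2 * y ^+ 2 * (y ^+ n.+1 - x ^+ n.+1).
Proof.
set d := y - x.
have e11 m : d * pfrac x y 1 1 m = y ^+ m.+1 - x ^+ m.+1.
  by rewrite pfrac_sub pfrac0l pfrac0r /= !bin0 !mul1r.
have e21 m : d * pfrac x y 2 1 m = pfrac x y 1 1 m.+1 - m.+2%:R * x ^+ m.+1.
  by rewrite pfrac_sub pfrac0r /= bin1 addn1.
have e12 m : d * pfrac x y 1 2 m = m.+2%:R * y ^+ m.+1 - pfrac x y 1 1 m.+1.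
  by rewrite pfrac_sub pfrac0l /= bin1 addn1.
have e22 m : d * pfrac x y 2 2 m = pfrac x y 1 2 m.+1 - pfrac x y 2 1 m.+1.
  exact: pfrac_sub.
have e31 m : d * pfrac x y 3 1 m = pfrac x y 2 1 m.+1 - 'C(m.+3, 2)%:R * x ^+ m.+1.
  by rewrite pfrac_sub pfrac0r /= addn2.
have e13 m : d * pfrac x y 1 3 m = 'C(m.+3, 2)%:R * y ^+ m.+1 - pfrac x y 1 2 m.+1.
  by rewrite pfrac_sub pfrac0l /= addn2.
have bS m : 'C(m.+1, 2)%:R = 'C(m, 2)%:R + m%:R :> F by rewrite binS bin1 natrD.
have -> : d ^+ 5 * pfrac x y 3 3 n = d ^+ 4 * (d * pfrac x y 3 3 n) by ring.
rewrite pfrac_sub.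
have -> : d ^+ 4 * (pfrac x y 2 3 n.+1 - pfrac x y 3 2 n.+1) =
  d ^+ 3 * (d * pfrac x y 2 3 n.+1 - d * pfrac x y 3 2 n.+1) by ring.
rewrite !pfrac_sub.
have -> : d ^+ 3 * (pfrac x y 1 3 n.+2 - pfrac x y 2 2 n.+2 - (pfrac x y 2 2 n.+2 - pfrac x y 3 1 n.+2)) =
  d ^+ 2 * (d * pfrac x y 1 3 n.+2 - 2 * (d * pfrac x y 2 2 n.+2) + d * pfrac x y 3 1 n.+2) by ring.
rewrite e13 e22 e31.
set b := 'C(n.+4.+1, 2)%:R.
have -> : d ^+ 2 * (b * y ^+ n.+3 - pfrac x y 1 2 n.+3 - 2 * (pfrac x y 1 2 n.+3 - pfrac x y 2 1 n.+3) + (pfrac x y 2 1 n.+3 - b * x ^+ n.+3)) =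
  d * (d * b * (y ^+ n.+3 - x ^+ n.+3) - 3 * (d * pfrac x y 1 2 n.+3) + 3 * (d * pfrac x y 2 1 n.+3)) by ring.
rewrite e12 e21.
set g := pfrac x y 1 1 n.+4.
have -> : d * (d * b * (y ^+ n.+3 - x ^+ n.+3) - 3 * (n.+4.+1%:R * y ^+ n.+4 - g) + 3 * (g - n.+4.+1%:R * x ^+ n.+4)) =
  d ^+ 2 * b * (y ^+ n.+3 - x ^+ n.+3) - 3 * d * n.+4.+1%:R * (y ^+ n.+4 + x ^+ n.+4) + 6 * (d * g) by ring.
rewrite /g e11 /b !bS /d -!natr1 !exprS; ring.
Qed.

End PartialFractions.

Section PartialFractionsField.
Variable F : fieldType.
Implicit Types u v : F.

(** Each term pairs u or v with u - v, again two independent lattice points. All exponents are at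
    least 3 as soon as n >= 2. *)
Definition pfrac_rest u v n : F :=
  'C(n.+2, 2)%:R * (v ^- n.+3 * (u - v) ^- 3)
  + - 'C(n.+2, 2)%:R * (u ^- n.+3 * (u - v) ^- 3)
  + - (3 * n.+1%:R) * (u ^- n.+2 * (u - v) ^- 4)
  + - (3 * n.+1%:R) * (v ^- n.+2 * (u - v) ^- 4)
  + 6 * (v ^- n.+1 * (u - v) ^- 5) + - 6 * (u ^- n.+1 * (u - v) ^- 5).

(** At u = 0 [pfrac_rest] equals minus this multiple of v ^- (n + 6), and symmetrically at v = 0. *)
Definition axis_coef n := ('C(n.+2, 2) + 3 * n.+1 + 6)%N.

Lemma pfrac_inv0 u v n : u * v = 0 ->
  \sum_(i < n.+1) (mbin 3 i * mbin 3 (n - i))%:R * (u ^- (3 + i) * v ^- (3 + (n - i))) = 0.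
Proof.
move/eqP; rewrite mulf_eq0 => /orP[] /eqP ->;
  by apply: big1 => i _; rewrite expr0n addSn /= invr0 ?mul0r !mulr0.
Qed.

(* The last three terms account for the junk value 0 ^- 1 = 0. *)
Lemma pfrac_inv u v n :
  \sum_(i < n.+1) (mbin 3 i * mbin 3 (n - i))%:R * (u ^- (3 + i) * v ^- (3 + (n - i))) =
  pfrac_rest u v n + (mbin 6 n)%:R * ((u == v)%:R * u ^- (n + 6))
  + (axis_coef n)%:R * ((u == 0)%:R * v ^- (n + 6))
  + (axis_coef n)%:R * ((v == 0)%:R * u ^- (n + 6)).
Proof.
have [->|u0] := eqVneq u 0.
  rewrite pfrac_inv0 ?mul0r // /pfrac_rest sub0r !expr0n addn_eq0 andbF /= invr0 !mul0r !mulr0.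
  have [->|v0] := eqVneq v 0; first by rewrite ?oppr0 !expr0n ?addn_eq0 ?andbF /= ?invr0; ring.
  rewrite /axis_coef -!exprVn invrN !natrD natrM (addnC n 6%N) (exprD _ 6%N n) !exprS; ring.
have [->|v0] := eqVneq v 0.
  rewrite pfrac_inv0 ?mulr0 // (negPf u0) /pfrac_rest subr0 !expr0n /= invr0 !mul0r !mulr0.
  rewrite /axis_coef -!exprVn !natrD natrM (addnC n 6%N) (exprD _ 6%N n) !exprS; ring.
rewrite !mul0r !mulr0 !addr0.
have [->|uv] := eqVneq u v.
  rewrite -[mbin 6 n](mbin_conv 3 3 n) natr_sum mulr_suml /pfrac_rest subrr !expr0n invr0 !mulr0 !add0r.
  apply: eq_bigr => i _; congr (_ * _).
  by rewrite mul1r -invfM -exprD; congr (_ ^- _); have := ltn_ord i; lia.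
rewrite mul0r mulr0 addr0.
have uv0 : u - v != 0 by rewrite subr_eq0.
have -> : \sum_(i < n.+1) (mbin 3 i * mbin 3 (n - i))%:R * (u ^- (3 + i) * v ^- (3 + (n - i))) =
  u ^- 3 * v ^- 3 * pfrac u^-1 v^-1 3 3 n.
  rewrite /pfrac mulr_sumr; apply: eq_bigr => i _.
  by rewrite natrM -!exprVn !exprD; ring.
have dE : v^-1 - u^-1 = (u - v) * (u^-1 * v^-1) by field; rewrite u0 v0.
have xy0 : u^-1 * v^-1 != 0 by rewrite mulf_neq0 ?invr_eq0.
apply: (mulfI (_ : (v^-1 - u^-1) ^+ 5 != 0)); first by rewrite expf_neq0 // dE mulf_neq0.
rewrite mulrCA pfrac33 /pfrac_rest -!exprVn.
have wE : (u - v)^-1 = u^-1 * v^-1 / (v^-1 - u^-1).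
  by rewrite dE invfM mulrCA mulfV ?mulr1.
have d0 : v^-1 - u^-1 != 0 by rewrite dE mulf_neq0.
rewrite wE; move: (u^-1) (v^-1) d0 => x y; set d := y - x => d0.
rewrite !exprS expr0 !mulr1; move: (x ^+ n) (y ^+ n) ('C(_, _)%:R) (n.+1%:R) => X Y c m.
rewrite /d in d0 *; by field.
Qed.

End PartialFractionsField.

Section LatticeRecursion.
Variable (R : realType) (z : R[i]).
Hypothesis z0 : 0 < complex.Im z.
Notation G k := (latticeG k z).
Notation L := (int * int)%type.

Lemma omega_eq0 p : (omega z p == 0) = (p == 0).
Proof.
by apply/idP/eqP => [|->]; [apply: contraTeq => /(omega_neq0 z0)|rewrite omega0].
Qed.

Lemma latticeG_odd k : (2 < k)%N -> odd k -> G k = 0.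
Proof.
move=> k2 ok; have hG := has_sum_latticeG z0 k2.
have hN : has_sum (fun p => omega z p ^- k) (-1 * G k).
  apply: (has_sum_reindex (j := -%R : L -> L) oppr_inj _ _ (has_sumZ (-1) hG)).
    move=> p; rewrite -[- p]sub0r omegaB omega0 sub0r -!exprVn invrN exprNn.
    by rewrite -signr_odd ok expr1.
  by move=> l hl; case: (hl (- l)); rewrite opprK.
have := has_sum_unique hG hN; rewrite mulN1r => /eqP; rewrite -addr_eq0 -mulr2n.
by rewrite mulrn_eq0 => /eqP.
Qed.

Lemma has_sum_pair a b : (2 < a)%N -> (2 < b)%N ->
  has_sum (fun p : L * L => omega z p.1 ^- a * omega z p.2 ^- b) (G a * G b).
Proof.
move=> a2 b2; have [c hc] := omega_dom z0 a2; have [d hd] := omega_dom z0 b2.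
exact: (has_sum_prod hc hd (bounded_sumsZ (domc_ge0 hc) (@bounded_sums_dom R))
  (bounded_sumsZ (domc_ge0 hd) (@bounded_sums_dom R)) (has_sum_latticeG z0 a2) (has_sum_latticeG z0 b2)).
Qed.

Lemma has_sum_pair_diff1 a b : (2 < a)%N -> (2 < b)%N ->
  has_sum (fun p : L * L => omega z p.1 ^- a * (omega z p.1 - omega z p.2) ^- b) (G a * G b).
Proof.
move=> a2 b2; apply: (has_sum_reindex (j := fun p : L * L => (p.1, p.1 - p.2)) _ _ _ (has_sum_pair a2 b2)).
- by move=> [p1 p2] [q1 q2] e; have := congr1 snd e; have /= -> := congr1 fst e => /addrI/oppr_inj ->.
- by move=> [p1 p2] /=; rewrite -omegaB opprB addrC subrK.
- by move=> [p1 p2] h; case: (h (p1, p1 - p2)); rewrite /= opprB addrC subrK.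
Qed.

Lemma has_sum_pair_diff2 a b : (2 < a)%N -> (2 < b)%N ->
  has_sum (fun p : L * L => omega z p.2 ^- a * (omega z p.1 - omega z p.2) ^- b) (G a * G b).
Proof.
move=> a2 b2; apply: (has_sum_reindex (j := fun p : L * L => (p.2 + p.1, p.1)) _ _ _ (has_sum_pair a2 b2)).
- by move=> [p1 p2] [q1 q2] e; have := congr1 fst e; have /= -> := congr1 snd e => /addIr ->.
- by move=> [p1 p2] /=; rewrite -omegaB addrK.
- by move=> [p1 p2] h; case: (h (p2, p1 - p2)); rewrite /= subrK.
Qed.

Lemma has_sum_pair_supp (j : L -> L * L) (P : pred (L * L)) (f : L * L -> R[i]) k :
  (2 < k)%N -> injective j -> (forall p, P (j p)) -> (forall q, P q -> exists p, j p = q) ->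
  (forall p, f (j p) = omega z p ^- k) ->
  has_sum (fun q => (P q)%:R * f q) (G k).
Proof.
move=> k2 inj Pj jP fj; apply: (has_sum_reindex inj _ _ (has_sum_latticeG z0 k2)).
  by move=> p; rewrite Pj mul1r fj.
move=> q hq; case: (boolP (P q)) => [/jP[p pq]|_]; last by rewrite mul0r.
by case: (hq p).
Qed.

Lemma has_sum_diag k : (2 < k)%N ->
  has_sum (fun p : L * L => (omega z p.1 == omega z p.2)%:R * omega z p.1 ^- k) (G k).
Proof.
move=> k2; apply: (has_sum_pair_supp (j := fun p => (p, p))
  (P := fun p => omega z p.1 == omega z p.2) (f := fun p => omega z p.1 ^- k) k2) => /=; rewrite ?omega0 ?eqxx //.
- by move=> p q [].
- by move=> [p q] /=; rewrite -subr_eq0 -omegaB omega_eq0 subr_eq0 => /eqP ->; exists q.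
Qed.

Lemma has_sum_axis1 k : (2 < k)%N ->
  has_sum (fun p : L * L => (omega z p.1 == 0)%:R * omega z p.2 ^- k) (G k).
Proof.
move=> k2; apply: (has_sum_pair_supp (j := fun p => (0, p))
  (P := fun p => omega z p.1 == 0) (f := fun p => omega z p.2 ^- k) k2) => /=; rewrite ?omega0 ?eqxx //.
- by move=> p q [].
- by move=> [p q] /=; rewrite omega_eq0 => /eqP ->; exists q.
Qed.

Lemma has_sum_axis2 k : (2 < k)%N ->
  has_sum (fun p : L * L => (omega z p.2 == 0)%:R * omega z p.1 ^- k) (G k).
Proof.
move=> k2; apply: (has_sum_pair_supp (j := fun p => (p, 0))
  (P := fun p => omega z p.2 == 0) (f := fun p => omega z p.1 ^- k) k2) => /=; rewrite ?omega0 ?eqxx //.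
- by move=> p q [].
- by move=> [p q] /=; rewrite omega_eq0 => /eqP ->; exists p.
Qed.

(** Summing [pfrac_inv] over all pairs, the products G_(n+3) G_3 and G_(n+1) G_5 occur with both
    signs and cancel, while the two terms giving G_(n+2) G_4 add up. *)
Lemma latticeG_conv n : (1 < n)%N ->
  \sum_(i < n.+1) (mbin 3 i * mbin 3 (n - i))%:R * (G (3 + i) * G (3 + (n - i))) =
  - (6 * n.+1%:R) * (G n.+2 * G 4) + (mbin 6 n + 2 * axis_coef n)%:R * G (n + 6).
Proof.
move=> n1.
have h1 : has_sum (fun p : L * L => \sum_(i < n.+1) (mbin 3 i * mbin 3 (n - i))%:R *
    (omega z p.1 ^- (3 + i) * omega z p.2 ^- (3 + (n - i))))
    (\sum_(i < n.+1) (mbin 3 i * mbin 3 (n - i))%:R * (G (3 + i) * G (3 + (n - i)))).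
  by apply: has_sum_sum => i _; apply: has_sumZ; apply: has_sum_pair.
have n6 : (2 < n + 6)%N by lia.
have h2 := has_sumD (has_sumD (has_sumD (has_sumD (has_sumD (has_sumD (has_sumD (has_sumD
   (has_sumZ 'C(n.+2, 2)%:R (has_sum_pair_diff2 (a := n.+3) (b := 3) isT isT))
   (has_sumZ (- 'C(n.+2, 2)%:R) (has_sum_pair_diff1 (a := n.+3) (b := 3) isT isT)))
   (has_sumZ (- (3 * n.+1%:R)) (has_sum_pair_diff1 (a := n.+2) (b := 4) (ltnW n1) isT)))
   (has_sumZ (- (3 * n.+1%:R)) (has_sum_pair_diff2 (a := n.+2) (b := 4) (ltnW n1) isT)))
   (has_sumZ 6 (has_sum_pair_diff2 (a := n.+1) (b := 5) n1 isT)))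
   (has_sumZ (- 6) (has_sum_pair_diff1 (a := n.+1) (b := 5) n1 isT)))
   (has_sumZ (mbin 6 n)%:R (has_sum_diag n6)))
   (has_sumZ (axis_coef n)%:R (has_sum_axis1 n6)))
   (has_sumZ (axis_coef n)%:R (has_sum_axis2 n6)).
rewrite (has_sum_unique h1 (has_sum_eq _ h2)).
  by rewrite !natrD !natrM; ring.
by move=> p; rewrite pfrac_inv.
Qed.

Lemma sum_odd_index (V : nmodType) (f : nat -> V) p :
  (forall i, ~~ odd i -> f i = 0) ->
  \sum_(i < p.*2.+1) f i = \sum_(j < p) f j.*2.+1.
Proof.
move=> f0; elim: p => [|p IH]; first by rewrite big_ord_recr !big_ord0 /= f0 // addr0.
by rewrite doubleS 2!big_ord_recr /= IH [RHS]big_ord_recr /= (f0 p.*2.+2) /= ?odd_double // addr0.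
Qed.

(* The coefficients of [wp(s) = s^-2 + \sum_m e_m s^(2 m - 2)]. *)
Definition wpcoef m : R[i] := if (m < 2)%N then 0 else (m.*2.-1)%:R * G m.*2.

(** The factor 2 q + 7 is the normalisation 2 m - 1 of [wpcoef] at m = q + 4. *)
Lemma leading_coef q : (30 * (mbin 6 q.+1.*2 + 2 * axis_coef q.+1.*2) =
  (2 * q + 7) * ((q + 3) * (2 * q + 9) * (2 * q ^ 2 + 3 * q + 10)))%N.
Proof.
have h5 : ('C(2 * q + 7, 5) * 120 = (2 * q + 7) * (2 * q + 6) * (2 * q + 5) * (2 * q + 4) * (2 * q + 3))%N.
  rewrite -[120%N]/(5`!) bin_ffact !addnS addn0 !ffactSS ffactn0; ring.
have h2 : ('C(2 * q + 4, 2) * 2 = (2 * q + 4) * (2 * q + 3))%N.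
  rewrite -[2%N in X in X = _]/(2`!) bin_ffact !addnS addn0 !ffactSS ffactn0; ring.
have e1 : mbin 6 q.+1.*2 = 'C(2 * q + 7, 5) by rewrite /=; congr 'C(_, _); lia.
have e2 : axis_coef q.+1.*2 = ('C(2 * q + 4, 2) + 3 * (2 * q + 3) + 6)%N.
  by rewrite /axis_coef; congr ('C(_, _) + 3 * _ + _)%N; lia.
apply/eqP; rewrite -(eqn_pmul2l (isT : (0 < 4)%N)) e1 e2; apply/eqP.
transitivity ('C(2 * q + 7, 5) * 120 + 120 * ('C(2 * q + 4, 2) * 2) + 240 * (3 * (2 * q + 3) + 6))%N.
  by ring.
by rewrite h5 h2; ring.
Qed.

(** In 'C(2 j + 3, 2) = (j + 1) (2 j + 3) the first factor becomes the weight i - 1 of [wp_rec] at i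
    = j + 2, the second the normalisation of e_i. *)
Lemma wpcoefE j : (mbin 3 j.*2.+1)%:R * G (3 + j.*2.+1) = j.+1%:R * wpcoef j.+2.
Proof.
have -> : mbin 3 j.*2.+1 = (j.+1 * j.*2.+3)%N.
  rewrite [LHS]/= addn2 -addn1; apply/eqP; rewrite -(eqn_pmul2r (isT : (0 < 2`!)%N)) bin_ffact.
  by rewrite !addnS addn0 !ffactSS ffactn0; apply/eqP; rewrite -[2`!]/2%N; lia.
by rewrite /wpcoef /= natrM mulrA !doubleS.
Qed.

Lemma wpcoef_rec : wp_rec wpcoef.
Proof.
move=> q; have n1 : (1 < q.+1.*2)%N by lia.
have := latticeG_conv n1.
rewrite (sum_odd_index (f := fun i => (mbin 3 i * mbin 3 (q.+1.*2 - i))%:R *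
   (G (3 + i) * G (3 + (q.+1.*2 - i))))); last first.
  by move=> i ei; rewrite latticeG_odd ?mul0r ?mulr0 //= !negbK.
move/(congr1 (fun x => 30 * x)).
pose S := \sum_(j < q.+1) (j.+1 * (q - j).+1)%:R * (wpcoef j.+2 * wpcoef (q - j).+2).
have -> : \sum_(i < q.+4.+1) (i.-1 * (q.+4 - i).-1)%:R * (wpcoef i * wpcoef (q.+4 - i)%N) = S.
  rewrite 2!big_ord_recl /= !mul0n !mul0r !add0r 2!big_ord_recr /=.
  rewrite /bump /= !add1n !subSS subnn subSn // subnn /= !muln0 !mul0r !addr0.
  apply: eq_bigr => i _; rewrite !add1n !subSS.
  by rewrite (_ : q.+2 - i = (q - i).+2)%N //; have := ltn_ord i; lia.
have -> : \sum_(j < q.+1) (mbin 3 j.*2.+1 * mbin 3 (q.+1.*2 - j.*2.+1))%:R *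
      (G (3 + j.*2.+1) * G (3 + (q.+1.*2 - j.*2.+1))) = S.
  apply: eq_bigr => i _; have iq : (i <= q)%N by rewrite -ltnS.
  have -> : (q.+1.*2 - i.*2.+1 = (q - i).*2.+1)%N by rewrite -!muln2 mulnBl; lia.
  rewrite [LHS](_ : _ = ((mbin 3 i.*2.+1)%:R * G (3 + i.*2.+1)) *
      ((mbin 3 (q - i).*2.+1)%:R * G (3 + (q - i).*2.+1))); last by rewrite natrM; ring.
  by rewrite !wpcoefE natrM; ring.
move=> h; rewrite h.
have -> : wpcoef q.+4 = (2 * q + 7)%:R * G (q.+1.*2 + 6).
  by rewrite /wpcoef /=; congr (_%:R * latticeG _ _); lia.
have -> : wpcoef q.+2 = q.+1.*2.+1%:R * G q.+1.*2.+2.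
  by rewrite /wpcoef /=.
have -> : wpcoef 2 = 3 * G 4 by [].
set c := ((q + 3) * _ * _)%N.
transitivity (((2 * q + 7) * c)%:R * G (q.+1.*2 + 6)); first by rewrite natrM; ring.
by rewrite /c -leading_coef natrM; ring.
Qed.

End LatticeRecursion.

(** * The imaginary axis *)

Section ImaginaryAxis.
Variable R : realType.
Implicit Types t u : R.
Notation L := (int * int)%type.

Definition iaxis t : R[i] := Complex 0 t.

Lemma omega_iaxis t p : omega (iaxis t) p = Complex (p.2%:~R) (p.1%:~R * t).
Proof.
rewrite /omega /iaxis.
have cint (m : int) : m%:~R = (m%:~R : R)%:C by rewrite rmorph_int.
by rewrite !cint; apply/eqP; rewrite eq_complex /=; apply/andP; split; apply/eqP; ring.
Qed.

Lemma normc_iaxis t p : Normc.normc (omega (iaxis t) p) = Num.sqrt (p.2%:~R ^+ 2 + (p.1%:~R * t) ^+ 2).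
Proof. by rewrite omega_iaxis. Qed.

Lemma iaxis_sqr_ge t p : 1 <= t ->
  (p.1%:~R ^+ 2 + p.2%:~R ^+ 2 : R) <= p.2%:~R ^+ 2 + (p.1%:~R * t) ^+ 2.
Proof.
move=> t1; rewrite addrC lerD2l exprMn ler_peMr ?sqr_ge0 // expr_ge1 //; lra.
Qed.

Lemma iaxis_ge t p : 1 <= t -> p != 0 ->
  2^-1 * Num.sqrt (domq R p) <= Normc.normc (omega (iaxis t) p).
Proof.
move=> t1 p0; rewrite normc_iaxis ler_pdivrMl //.
have -> : 2 = Num.sqrt (2 ^+ 2) :> R by rewrite sqrtr_sqr ger0_norm.
rewrite -sqrtrM ?sqr_ge0 //; apply: ler_wsqrtr; apply: le_trans (domq_le R p0) _.
have := iaxis_sqr_ge p t1; lra.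
Qed.

Lemma iaxis_neq0 t p : 1 <= t -> p != 0 -> omega (iaxis t) p != 0.
Proof. by move=> t1; apply: omega_neq0; rewrite /=; lra. Qed.

Lemma iaxis_inv_le t k p : 1 <= t -> (2 < k)%N ->
  `|omega (iaxis t) p ^- k| <= (2 ^+ k * dom R p)%:C.
Proof.
move=> t1 k2; have [->|p0] := eqVneq p 0.
  rewrite omega0 expr0n gtn_eqF ?(ltn_trans _ k2) //= invr0 normr0 ler0c.
  by rewrite mulr_ge0 ?exprn_ge0 ?ltW ?dom_gt0.
have := omega_inv_le (_ : 0 < 2^-1) k2 (iaxis_ge t1 p0).
by rewrite exprVn invrK; apply; rewrite invr_gt0.
Qed.

Lemma iaxis_gt0 t : 1 <= t -> 0 < complex.Im (iaxis t).
Proof. by rewrite /=; lra. Qed.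

(** With X and Y the two inverses, X^k - Y^k has the factor X - Y, of size |t - u| |m| |X| |Y| for p
    = (m, n). Since |m X| <= 1, the factor |m| costs no decay and the bound stays summable,
    uniformly in t and u. *)
Lemma iaxis_lip_term t u k p : 1 <= t -> 1 <= u -> (2 < k)%N ->
  `|omega (iaxis t) p ^- k - omega (iaxis u) p ^- k| <=
  (k%:R * `|t - u| * 2 ^+ k * dom R p)%:C.
Proof.
move=> t1 u1 k2; have [->|p0] := eqVneq p 0.
  rewrite !omega0 subrr normr0 ler0c; apply: mulr_ge0; last exact/ltW/dom_gt0.
  by rewrite !mulr_ge0 // exprn_ge0.
have t0 := iaxis_neq0 t1 p0; have u0 := iaxis_neq0 u1 p0.
set r := (2^-1 * Num.sqrt (domq R p))^-1.
have q1 : 1 <= Num.sqrt (domq R p) by rewrite -sqrtr1; apply/ler_wsqrtr/domq_ge1.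
have r'0 : 0 < 2^-1 * Num.sqrt (domq R p) by rewrite mulr_gt0 ?invr_gt0 //; exact: lt_le_trans q1.
have bound v : 1 <= v -> `|(omega (iaxis v) p)^-1| <= r%:C.
  move=> v1; rewrite normfV (_ : `|_| = (Normc.normc (omega (iaxis v) p))%:C) // -fmorphV lecR.
  by rewrite lef_pV2 ?posrE ?iaxis_ge //; apply: lt_le_trans (iaxis_ge v1 p0).
set X := (omega (iaxis t) p)^-1; set Y := (omega (iaxis u) p)^-1.
have r0 : 0 <= r%:C :> R[i] by exact: le_trans (normr_ge0 _) (bound t t1).
have XY : `|X - Y| <= (`|t - u|)%:C * r%:C.
  have -> : X - Y = (omega (iaxis u) p - omega (iaxis t) p) * X * Y.
    by rewrite /X /Y; field; rewrite t0 u0.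
  have -> : omega (iaxis u) p - omega (iaxis t) p = (u - t)%:C * ('i * p.1%:~R).
    rewrite !omega_iaxis -(rmorph_int (real_complex R)).
    by apply/eqP; rewrite eq_complex /=; apply/andP; split; apply/eqP; ring.
  rewrite normrM normrM normrM -mulrA -mulrA.
  have -> : `|(u - t)%:C| = (`|t - u|)%:C by rewrite distrC normc_def /= expr0n addr0 sqrtr_sqr.
  rewrite ler_wpM2l ?ler0c // mulrA -[leRHS]mul1r; apply: ler_pM (bound u u1) => //.
  rewrite /X normfV ler_pdivrMr ?normr_gt0 // mul1r omega_iaxis.
  have cint (m : int) : m%:~R = (m%:~R : R)%:C by rewrite rmorph_int.
  have -> : 'i * p.1%:~R = Complex 0 p.1%:~R :> R[i].
    by rewrite cint; apply/eqP; rewrite eq_complex /=; apply/andP; split; apply/eqP; ring.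
  rewrite !normc_def lecR ler_wsqrtr //= expr0n add0r.
  rewrite exprMn; apply: le_trans (_ : (p.1%:~R ^+ 2 * t ^+ 2) <= _); last by rewrite lerDr sqr_ge0.
  by rewrite ler_peMr ?sqr_ge0 // expr_ge1 //; lra.
rewrite -!exprVn -/X -/Y subrXX normrM.
have sumle : `|\sum_(i < k) X ^+ (k.-1 - i) * Y ^+ i| <= r%:C ^+ k.-1 *+ k.
  apply: le_trans (ler_norm_sum _ _ _) _.
  have -> : r%:C ^+ k.-1 *+ k = \sum_(i < k) r%:C ^+ k.-1 :> R[i] by rewrite sumr_const card_ord.
  apply: ler_sum => i _; rewrite normrM !normrX.
  have -> : r%:C ^+ k.-1 = r%:C ^+ (k.-1 - i) * r%:C ^+ i :> R[i].
    rewrite -exprD subnK //; have := ltn_ord i; clear -k2; case: k k2 i => // k _ i; exact: id.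
  by apply: ler_pM; rewrite ?exprn_ge0 //; apply: lerXn2r; rewrite ?nnegrE ?bound.
apply: (@le_trans _ _ ((`|t - u|)%:C * r%:C * (r%:C ^+ k.-1 *+ k))).
  by apply: ler_pM; rewrite ?normr_ge0.
rewrite -rmorphXn -rmorphMn -!rmorphM /= lecR.
have -> : `|t - u| * r * (r ^+ k.-1 *+ k) = k%:R * `|t - u| * r ^+ k.
  by rewrite -[k in RHS](prednK (ltn_trans _ k2)) // exprS prednK ?(ltn_trans _ k2) // -mulr_natl; ring.
rewrite -[leRHS]mulrA ler_wpM2l // ?mulr_ge0 //.
rewrite /r invfM invrK exprMn ler_wpM2l ?exprn_ge0 // domE exprVn lef_pV2 ?posrE ?exprn_gt0 ?(lt_le_trans _ q1) //.
exact: ler_weXn2l.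
Qed.

Lemma latticeG_lip k : (2 < k)%N -> exists2 C : R, 0 <= C &
  forall t u, 1 <= t -> 1 <= u ->
  `|latticeG k (iaxis t) - latticeG k (iaxis u)| <= (C * `|t - u|)%:C.
Proof.
move=> k2; exists (k%:R * 2 ^+ k * 36); first by rewrite !mulr_ge0 ?exprn_ge0.
move=> t u t1 u1.
have ht := has_sum_latticeG (iaxis_gt0 t1) k2; have hu := has_sum_latticeG (iaxis_gt0 u1) k2.
have := has_sumD ht (has_sumZ (-1) hu).
rewrite mulN1r => h.
apply: (has_sum_le (b := fun p => (k%:R * `|t - u| * 2 ^+ k * dom R p)%:C) _ _ h).
  by move=> p; rewrite mulN1r; exact: iaxis_lip_term.
move=> A; rewrite -rmorph_sum lecR -mulr_sumr.
have -> : k%:R * 2 ^+ k * 36 * `|t - u| = k%:R * `|t - u| * 2 ^+ k * 36 by ring.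
by rewrite ler_wpM2l ?bounded_sums_dom // !mulr_ge0 // exprn_ge0.
Qed.

Lemma has_sum_Re_ge (x : L -> R[i]) s c (A0 : {fset L}) : has_sum x s ->
  (forall A : {fset L}, (A0 `<=` A)%fset -> c <= \sum_(p <- A) complex.Re (x p)) ->
  c <= complex.Re s.
Proof.
move=> /has_sumP h hA; apply/ler_addgt0Pr => e e0.
have [|A h1] := h e%:C; first by rewrite ltcR.
have /h1 := fsubsetUl A A0; have := hA _ (fsubsetUr A A0).
move: (A `|` A0)%fset => B cB sB.
have : `|complex.Re (s - \sum_(p <- B) x p)| < e.
  by rewrite -ltcR; apply: le_lt_trans sB; exact: normc_ge_Re.
rewrite raddfB raddf_sum /= ltr_norml => /andP[h2 h3].
apply: le_trans cB _; move: h2; lra.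
Qed.

(* The terms with [p = (0, 1)] and [p = (0, - 1)] contribute [2]. *)
Lemma latticeG_Re_ge t k (c : R) : 1 <= t -> (2 < k)%N -> ~~ odd k -> 0 <= c ->
  (forall p, p != 0 -> (p.1 == 0) && (`|p.2|%N == 1%N) = false ->
    - (c * dom R p) <= complex.Re (omega (iaxis t) p ^- k)) ->
  2 - c * 36 <= complex.Re (latticeG k (iaxis t)).
Proof.
move=> t1 k2 ek c0 h.
pose A0 : {fset L} := [fset ((0, 1) : L); (0, -1)]%fset.
apply: (has_sum_Re_ge (A0 := A0) (has_sum_latticeG (iaxis_gt0 t1) k2)) => A A0A.
apply: (@le_trans _ _ (\sum_(p <- A) ((p \in A0)%:R - c * dom R p))).
  rewrite sumrB; apply: lerB.
    rewrite -(big_fset_incl _ A0A) => [|p _ /negPf ->] //.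
    rewrite big_seq (eq_bigr (fun=> 1)) => [|p ->] //.
    by rewrite -big_seq big_fsetU1 ?inE //= big_seq_fset1.
  by rewrite -mulr_sumr ler_wpM2l // bounded_sums_dom.
apply: ler_sum => p _; rewrite !inE.
have d0 : 0 <= c * dom R p by rewrite mulr_ge0 // ltW ?dom_gt0.
have [->|p0] := eqVneq p 0.
  rewrite omega0 expr0n gtn_eqF ?(ltn_trans _ k2) // invr0.
  rewrite (_ : _ || _ = false) // sub0r oppr_le0; exact: mulr_ge0 c0 (ltW (dom_gt0 _ _)).
have := h p p0; case: p d0 {p0 h} => m n /= d0 h.
case: (boolP ((m == 0) && (`|n|%N == 1%N))) h d0 => [/andP[/eqP -> /eqP n1] _ d0|mn h _].
  have -> : omega (iaxis t) (0, n) ^- k = 1.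
    rewrite omega_iaxis /= mul0r.
    have -> : Complex n%:~R 0 = n%:~R :> R[i] by rewrite -(rmorph_int (real_complex R)).
    rewrite -rmorphXn /=; have -> : n ^+ k = 1; last by rewrite invr1.
    by rewrite (intEsign n) n1 mulr1 -exprM mulnC exprM -signr_odd (negPf ek) expr0 expr1n.
  by rewrite (_ : complex.Re 1 = 1) //; case: (_ || _) => /=; lra.
apply: le_trans (h _); last exact: negbTE.
rewrite (_ : _ || _ = false) ?sub0r //.
by apply: contraNF mn => /orP[] /eqP[-> ->].
Qed.

End ImaginaryAxis.

(** * Zeros of G_6 and nonvanishing of G_24 on the imaginary axis *)

Section Zeros.
Variable R : realType.
Implicit Types t u : R.
Notation L := (int * int)%type.
Notation G k t := (latticeG k (iaxis t)).

Lemma Re_expV_real (x : R) k : ~~ odd k -> 0 <= complex.Re ((Complex x 0) ^- k).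
Proof.
move=> ek; rewrite -[Complex x 0]/(x%:C) -rmorphXn -fmorphV /= invr_ge0.
by rewrite -(odd_double_half k) (negPf ek) add0n -mul2n exprM exprn_ge0 // sqr_ge0.
Qed.

Lemma Re_expV_imag (y : R) k : 0 <= complex.Re ((Complex 0 y) ^- (4 * k)).
Proof.
have -> : (Complex 0 y) ^- (4 * k) = (Complex (y ^+ 2) 0) ^- (2 * k).
  rewrite (_ : 4 * k = 2 * (2 * k))%N; last by lia.
  rewrite exprM; have -> : Complex 0 y ^+ 2 = - Complex (y ^+ 2) 0.
    by rewrite expr2; apply/eqP; rewrite eq_complex /=; apply/andP; split; apply/eqP; ring.
  by rewrite !exprM sqrrN.
by apply: Re_expV_real; rewrite oddM.
Qed.

(** Four of the powers pay for summability, with constant 2 ^ 4 = 16; the other 2 j give the gain B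
    ^- j. *)
Lemma iaxis_inv_le2 t p (B : R) j : 1 <= t -> 0 < B ->
  B <= p.2%:~R ^+ 2 + (p.1%:~R * t) ^+ 2 ->
  - (16 / B ^+ j * dom R p) <= complex.Re (omega (iaxis t) p ^- (4 + 2 * j)).
Proof.
move=> t1 B0 Bp; set N := p.2%:~R ^+ 2 + _ in Bp.
have N0 : 0 <= N by rewrite addr_ge0 ?sqr_ge0.
set x := omega _ _ ^- _; suff : `|x| <= (16 / B ^+ j * dom R p)%:C.
  move=> xb; rewrite lerNl; apply: le_trans (ler_norm _) _; rewrite normrN -lecR.
  exact: le_trans (normc_ge_Re _) xb.
rewrite /x exprD invfM normrM.
have h4 := iaxis_inv_le p t1 (isT : (2 < 4)%N).
have hj : `|omega (iaxis t) p ^- (2 * j)| = (N ^- j)%:C.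
  have nN : `|omega (iaxis t) p| ^+ 2 = N%:C.
    by rewrite (_ : `|_| = (Normc.normc (omega (iaxis t) p))%:C) // normc_iaxis -rmorphXn sqr_sqrtr.
  by rewrite normfV normrX exprM nN -rmorphXn -fmorphV.
rewrite hj -mulrA [_^-1 * _]mulrC mulrA rmorphM; apply: ler_pM => //.
- by rewrite ler0c invr_ge0 exprn_ge0.
- by apply: le_trans h4 _; rewrite lecR (_ : 2 ^+ 4 = 16 :> R) //; ring.
- rewrite lecR lef_pV2 ?posrE ?exprn_gt0 ?(lt_le_trans B0) //.
  by apply: lerXn2r; rewrite ?nnegrE // ltW.
Qed.

Lemma intr_sqr_ge1 (m : int) : m != 0 -> 1 <= (m%:~R : R) ^+ 2.
Proof.
move=> m0; rewrite -rmorphXn /= ler1z; have := sqr_ge0 m; move: m0; rewrite -sqrf_eq0.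
by move: (m ^+ 2) => x; lia.
Qed.

(** In a weight divisible by 4 the points on both axes contribute nonnegative real parts, and
    elsewhere |omega|^2 >= 2. Among the weights 4 + 2 j divisible by 4, 24 is the first with 36 * 16
    / 2^j < 2. *)
Lemma G24_neq0 t : 1 <= t -> G 24 t != 0.
Proof.
move=> t1; suff : 2 - 64^-1 * 36 <= complex.Re (G 24 t).
  by apply: contraTneq => ->; rewrite -ltNge /=; lra.
apply: latticeG_Re_ge => // p p0 pn.
have d0 : 0 <= 64^-1 * dom R p by rewrite mulr_ge0 // ltW ?dom_gt0.
have [p1|p1] := eqVneq p.1 0.
  by rewrite omega_iaxis p1 mul0r; apply: le_trans (Re_expV_real _ _) => //; rewrite oppr_le0.
have [p2|p2] := eqVneq p.2 0.
  by rewrite omega_iaxis p2; apply: le_trans (Re_expV_imag _ 6) => //; rewrite oppr_le0.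
have := @iaxis_inv_le2 t p 2 10 t1 (ltr0Sn _ 1).
rewrite (_ : 16 / 2 ^+ 10 = 64^-1 :> R); last by field.
apply; rewrite -[2]/(1 + 1) lerD ?intr_sqr_ge1 // exprMn.
apply: le_trans (intr_sqr_ge1 p1) _; rewrite ler_peMr ?sqr_ge0 // expr_ge1 //; lra.
Qed.

(** Off the real axis |omega|^2 >= 400, and 36 * 16 / 400 < 2. *)
Lemma G6_neq0 t : 20 <= t -> G 6 t != 0.
Proof.
move=> t20; have t1 : 1 <= t by lra.
suff : 2 - 25^-1 * 36 <= complex.Re (G 6 t).
  by apply: contraTneq => ->; rewrite -ltNge /=; lra.
apply: latticeG_Re_ge => // p p0 pn.
have d0 : 0 <= 25^-1 * dom R p by rewrite mulr_ge0 // ltW ?dom_gt0.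
have [p1|p1] := eqVneq p.1 0.
  by rewrite omega_iaxis p1 mul0r; apply: le_trans (Re_expV_real _ _) => //; rewrite oppr_le0.
have := @iaxis_inv_le2 t p 400 1 t1 (ltr0Sn _ 399).
rewrite (_ : 16 / 400 ^+ 1 = 25^-1 :> R); last by field.
apply; apply: (@le_trans _ _ ((p.1%:~R * t) ^+ 2)); last by rewrite lerDr sqr_ge0.
have := intr_sqr_ge1 p1; rewrite exprMn => m1; nra.
Qed.

(** Multiplication by 'i permutes the Gaussian integers, and 'i ^ 6 = -1. *)
Lemma G6_i : G 6 (1 : R) = 0.
Proof.
have i1 : 0 < complex.Im (iaxis (1 : R)) by rewrite /= ltr01.
have hG := has_sum_latticeG i1 (isT : 2 < 6)%N.
have hN : has_sum (fun p => omega (iaxis (1 : R)) p ^- 6) (-1 * G 6 (1 : R)).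
  apply: (has_sum_reindex (j := fun p : L => (p.2, - p.1)) _ _ _ (has_sumZ (-1) hG)).
  - by move=> [a b] [c d] /= [-> /oppr_inj ->].
  - move=> [a b]; have -> : omega (iaxis (1 : R)) (b, - a) = 'i * omega (iaxis 1) (a, b).
      rewrite !omega_iaxis /= rmorphN /=; apply/eqP; rewrite eq_complex /=.
      by apply/andP; split; apply/eqP; ring.
    rewrite exprMn invfM; congr (_ * _).
    by rewrite (exprM _ 2 3) sqr_i exprS sqrrN expr1n mulr1 invrN1.
  - by move=> [a b] h; case: (h (- b, a)); rewrite /= opprK.
have := has_sum_unique hG hN; rewrite mulN1r => /eqP; rewrite -addr_eq0 -mulr2n.
by rewrite mulrn_eq0 => /eqP.
Qed.

(** The zeros include 1 and stop before 20. Their supremum is a zero by Lipschitz continuity. *)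
Lemma last_zero_G6 : exists2 s : R, 1 <= s & G 6 s = 0 /\ forall t, s < t -> G 6 t != 0.
Proof.
pose Z := [set t : R | 1 <= t /\ G 6 t = 0].
have supZ : has_sup Z.
  split; first by exists 1; split; rewrite ?G6_i.
  exists 20 => t [t1 t0]; rewrite leNgt; apply/negP => /ltW /G6_neq0.
  by rewrite t0 eqxx.
have s1 : 1 <= sup Z by apply: (ub_le_sup supZ.2); split; rewrite ?G6_i.
exists (sup Z) => //; split; last first.
  move=> t st; apply/eqP => t0.
  have : t <= sup Z by apply: (ub_le_sup supZ.2); split => //; apply: le_trans (ltW st).
  by rewrite leNgt st.
have [C C0 lip] := latticeG_lip R (isT : 2 < 6)%N.
apply/eqP; rewrite -normr_le0; apply/ler_addgt0Pr => e e0; rewrite add0r.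
have [r re] : exists r : R, e = r%:C by exists (complex.Re e); rewrite RRe_real // gtr0_real.
have r0 : 0 < r by move: e0; rewrite re ltcR.
have [|t [t1 t0] st] := sup_adherent (_ : 0 < r / (C + 1)) supZ.
  by rewrite divr_gt0 //; lra.
have ts : t <= sup Z by apply: (ub_le_sup supZ.2).
have := lip _ _ s1 t1; rewrite t0 subr0 => /le_trans; apply.
rewrite re lecR ger0_norm ?subr_ge0 //.
apply: (@le_trans _ _ (C * (r / (C + 1)))); first by rewrite ler_wpM2l //; lra.
by rewrite mulrA ler_pdivrMr; nra.
Qed.

End Zeros.

(** * Limits of sequences and linear independence of the monomials in G_4 and G_6 *)

Section Limits.
Variable K : numFieldType.

Definition seq_lim (u : nat -> K) (l : K) := u @ \oo --> (l : K^o).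

Lemma seq_lim_eq u v l : u =1 v -> seq_lim u l -> seq_lim v l.
Proof. by move=> /funext ->. Qed.

Lemma seq_lim_cst c : seq_lim (fun=> c) c.
Proof. exact: cvg_cst. Qed.

Arguments seq_lim_cst c : clear implicits.

Lemma seq_limD u v l m : seq_lim u l -> seq_lim v m -> seq_lim (fun n => u n + v n) (l + m).
Proof. exact: cvgD. Qed.

Lemma seq_limM u v l m : seq_lim u l -> seq_lim v m -> seq_lim (fun n => u n * v n) (l * m).
Proof. exact: cvgM. Qed.

Lemma seq_limX u l k : seq_lim u l -> seq_lim (fun n => u n ^+ k) (l ^+ k).
Proof.
move=> ul; elim: k => [|k IH]; first by rewrite expr0; apply: seq_lim_eq (seq_lim_cst 1) => n; rewrite expr0.
by rewrite exprS; apply: seq_lim_eq (seq_limM ul IH) => n; rewrite exprS.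
Qed.

Lemma seq_lim_sum I (r : seq I) (P : pred I) (u : I -> nat -> K) (l : I -> K) :
  (forall i, P i -> seq_lim (u i) (l i)) ->
  seq_lim (fun n => \sum_(i <- r | P i) u i n) (\sum_(i <- r | P i) l i).
Proof.
move=> h; elim: r => [|i r IH].
  by rewrite big_nil; apply: seq_lim_eq (seq_lim_cst 0) => n; rewrite big_nil.
rewrite big_cons; case: ifP => Pi.
  by apply: seq_lim_eq (seq_limD (h i Pi) IH) => n; rewrite big_cons Pi.
by apply: seq_lim_eq IH => n; rewrite big_cons Pi.
Qed.

Lemma seq_lim_unique u l m : seq_lim u l -> seq_lim u m -> l = m.
Proof. by move=> h1 h2; apply: (cvg_unique _ h1 h2). Qed.

End Limits.
Arguments seq_lim_cst {K} c.

Section Independence.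
Variable R : realType.
Notation G k t := (latticeG k (iaxis (t : R))).

Lemma C_char0 n : n.+1%:R != 0 :> R[i].
Proof. by rewrite pnatr_eq0. Qed.

(** A common zero would make every e_m vanish by the recursion, in particular e_12 = 23 G_24. *)
Lemma G4_neq0 t : 1 <= t -> G 6 t = 0 -> G 4 t != 0.
Proof.
move=> t1 g6; apply/eqP => g4; have z0 := iaxis_gt0 t1.
have e0 : wpcoef (iaxis t) =1 (fun=> 0).
  apply: (wp_rec_unique C_char0 (wpcoef_rec z0)).
    by move=> q; rewrite !(mul0r, mulr0) big1 ?mulr0 ?addr0 // => i _; rewrite !mulr0.
  by move=> [|[|[|[|//]]]] _; rewrite /wpcoef //= ?g4 ?g6 mulr0.
have := e0 12; rewrite /wpcoef /= => /eqP; rewrite mulf_eq0 pnatr_eq0 /=.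
by apply/negP; exact: G24_neq0.
Qed.

Lemma seq_lim_G k s : (2 < k)%N -> 1 <= s ->
  seq_lim (fun n => G k (s + n.+1%:R^-1)) (G k s).
Proof.
move=> k2 s1; have [C C0 lip] := latticeG_lip R k2.
apply/cvgrPdist_lt => e; rewrite ltcE /= => /andP[/eqP e0 e1].
have d0 : 0 < complex.Re e / (C + 1) by rewrite divr_gt0 //; lra.
have [N _ hN] := near_infty_natSinv_lt (PosNum d0).
exists N => // n /hN /= nd.
have n0 : 0 < n.+1%:R^-1 :> R by rewrite invr_gt0 ltr0n.
move: (n.+1%:R^-1) nd n0 => x xd x0.
apply: le_lt_trans (lip s (s + x) s1 _) _; first by lra.
have -> : `|s - (s + x)| = x by rewrite opprD addNKr normrN gtr0_norm.
rewrite ltcE /= e0 eqxx /=; move: xd; rewrite ltr_pdivlMr; last by lra.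
nra.
Qed.

Lemma G_indep k (d : nat -> rat) :
  (forall t, 1 <= t -> \sum_(a < k.+1) \sum_(b < k.+1 | (4 * a + 6 * b == k)%N)
     ratr (d a) * G 4 t ^+ a * G 6 t ^+ b = 0) ->
  forall b a, (4 * a + 6 * b = k)%N -> d a = 0.
Proof.
move=> h; elim/ltn_ind => b IH a ab.
have [s s1 [s0 sn]] := last_zero_G6 R.
(* By induction the terms with a smaller power of G_6 are gone. [Q] is the relation divided by y ^
   b, and at y = 0 only the term of [d a] survives. *)
pose Q (x y : R[i]) := ratr (d a) * x ^+ a + y * \sum_(a' < k.+1)
  \sum_(b' < k.+1 | ((4 * a' + 6 * b' == k) && (b < b'))%N) ratr (d a') * x ^+ a' * y ^+ (b' - b.+1).
have ak : (a < k.+1)%N by lia.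
have bk : (b < k.+1)%N by lia.
have hQ x y : \sum_(a' < k.+1) \sum_(b' < k.+1 | (4 * a' + 6 * b' == k)%N)
     ratr (d a') * x ^+ a' * y ^+ b' = y ^+ b * Q x y.
  rewrite /Q mulrDr [y ^+ b * (y * _)]mulrA -exprSr mulr_sumr.
  have -> : y ^+ b * (ratr (d a) * x ^+ a) = \sum_(a' < k.+1) \sum_(b' < k.+1)
     ((nat_of_ord a' == a) && (nat_of_ord b' == b))%:R * (y ^+ b * (ratr (d a) * x ^+ a)) :> R[i].
    rewrite (bigD1 (Ordinal ak)) //= [X in _ + X]big1 ?addr0; last first.
      move=> i ia; apply: big1 => j _; rewrite (_ : _ == a = false) ?mul0r //.
      by apply/negbTE; apply: contra ia => /eqP ia; apply/eqP/val_inj.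
    rewrite (bigD1 (Ordinal bk)) //= [X in _ + X]big1 ?addr0; last first.
      move=> i ia; rewrite (_ : _ && _ = false) ?mul0r //.
      by apply/negbTE; apply: contra ia => /andP[_ /eqP ia]; apply/eqP/val_inj.
    by rewrite !eqxx mul1r.
  rewrite -big_split; apply: eq_bigr => a' _ /=.
  rewrite big_mkcond mulr_sumr [X in _ + X]big_mkcond -big_split; apply: eq_bigr => b' _ /=.
  have [abk|abk] := eqVneq (4 * a' + 6 * b')%N k; last first.
    rewrite addr0 (_ : _ && _ = false) ?mul0r //.
    by apply/negbTE; apply: contra abk => /andP[/eqP -> /eqP ->]; apply/eqP.
  case: (ltngtP b' b) => bb /=.
  - by rewrite (IH _ bb a' abk) rmorph0 !mul0r andbF mul0r addr0.
  - rewrite andbF mul0r add0r -{1}(subnKC bb) exprD; ring.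
  - have -> : nat_of_ord a' = a by lia.
    by rewrite bb eqxx mul1r addr0 mulrC.
have Q0 n : Q (G 4 (s + n.+1%:R^-1)) (G 6 (s + n.+1%:R^-1)) = 0.
  have n0 : 0 < n.+1%:R^-1 :> R by rewrite invr_gt0 ltr0n.
  have xs : s < s + n.+1%:R^-1 by rewrite ltrDl.
  have /eqP := h _ (le_trans s1 (ltW xs)).
  by rewrite hQ mulf_eq0 expf_eq0 (negPf (sn _ xs)) andbF => /eqP.
have lim4 := seq_lim_G (isT : 2 < 4)%N s1; have lim6 := seq_lim_G (isT : 2 < 6)%N s1.
have limQ (g h' : nat -> R[i]) x y : seq_lim g x -> seq_lim h' y ->
    seq_lim (fun n => Q (g n) (h' n)) (Q x y).
  move=> gx hy; rewrite /Q.
  have l1 := seq_limM (seq_lim_cst (ratr (d a))) (seq_limX (k := a) gx).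
  have l2 (a' b' : 'I_k.+1) : seq_lim (fun n => ratr (d a') * g n ^+ a' * h' n ^+ (b' - b.+1))
      (ratr (d a') * x ^+ a' * y ^+ (b' - b.+1)).
    exact: (seq_limM (seq_limM (seq_lim_cst (ratr (d a'))) (seq_limX (k := a') gx)) (seq_limX (k := b' - b.+1) hy)).
  refine (seq_limD l1 (seq_limM hy _)).
  by apply: seq_lim_sum => a' _; apply: seq_lim_sum => b' _; exact: l2.
have := seq_lim_unique (limQ _ _ _ _ lim4 lim6) (seq_lim_eq (fun n => esym (Q0 n)) (seq_lim_cst 0)).
rewrite /Q s0 mul0r addr0 => /eqP; rewrite mulf_eq0 expf_eq0 (negPf (G4_neq0 s1 s0)) andbF orbF.
by rewrite fmorph_eq0 => /eqP.
Qed.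

End Independence.

(** * The expansion and its valuation *)

Section Evaluation.
Variables (F : numFieldType) (x y : F).

Definition eval_coef : {poly rat} -> F := horner_eval y \o map_poly (ratr : rat -> F).
HB.instance Definition _ := GRing.RMorphism.on eval_coef.
Definition evalQ : Q2 -> F := horner_eval x \o map_poly eval_coef.
HB.instance Definition _ := GRing.RMorphism.on evalQ.

Lemma evalQ_X : evalQ 'X = x.
Proof. by rewrite /evalQ /= map_polyX /horner_eval hornerX. Qed.

Lemma evalQ_Y : evalQ 'X%:P = y.
Proof. by rewrite /evalQ /eval_coef /= map_polyC /= /horner_eval hornerC map_polyX hornerX. Qed.

Lemma evalQ_rec e : wp_rec e -> wp_rec (evalQ \o e).
Proof.
move=> h q; have := congr1 evalQ (h q).
rewrite (rmorphM evalQ) (rmorph_nat evalQ) (rmorphD evalQ) !(rmorphM evalQ) !(rmorph_nat evalQ) (rmorph_sum evalQ) => ->.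
congr (_ * _ + _); apply: eq_bigr => i _.
by rewrite !(rmorphM evalQ) (rmorph_nat evalQ).
Qed.

Lemma evalQ_sum k (p : Q2) : (forall a b, (k < a)%N || (k < b)%N -> p`_a`_b = 0) ->
  evalQ p = \sum_(a < k.+1) \sum_(b < k.+1) ratr p`_a`_b * x ^+ a * y ^+ b.
Proof.
move=> p0; rewrite /evalQ /= /horner_eval (@horner_coef_wide _ k.+1); last first.
  apply: leq_trans (size_poly _ _) _; apply/leq_sizeP => a ak; apply/polyP => b.
  by rewrite coef0 p0 // ak.
apply: eq_bigr => a _; rewrite coef_map /= /eval_coef /= /horner_eval (@horner_coef_wide _ k.+1); last first.
  apply: leq_trans (size_poly _ _) _; apply/leq_sizeP => b bk.
  by rewrite p0 // bk orbT.
by rewrite mulr_suml; apply: eq_bigr => b _; rewrite coef_map /= mulrAC.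
Qed.

End Evaluation.

(** Applied in contrapositive form, to extract an odd coefficient from [red P != 0]. *)
Lemma red_eq0 (P : Z2) : (forall a b, ~~ odd (absz P`_a`_b)) -> red P = 0.
Proof.
move=> ev.
have int_even (i : int) : ~~ odd `|i|%N -> i%:~R = 0 :> {poly 'F_2}.
  move=> ei; rewrite (intEsign i) rmorphM /= -pmulrn poly_F2_nat (negPf ei) mulr0 //.
have c0 (a : nat) : red_coef P`_a = 0.
  rewrite /red_coef /= /horner_eval (_ : map_poly _ _ = 0) ?horner0 //.
  by apply/polyP => b; rewrite coef_map /= int_even ?coef0.
rewrite /red /= /horner_eval (_ : map_poly _ _ = 0) ?horner0 //.
by apply/polyP => a; rewrite coef_map /= c0 coef0.
Qed.

Lemma toQ_coef (P : Z2) a b : (toQ P)`_a`_b = (P`_a`_b)%:~R.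
Proof. by rewrite /toQ coef_map /= coef_map. Qed.

Lemma v2_eq (c : rat) n t (z : int) : odd n -> n%:R * c = (2 ^ t)%:R * z%:~R ->
  (t%:Z%:E <= v2 c)%E /\ (odd `|z|%N -> v2 c = t%:Z%:E).
Proof.
move=> on nc; have n0 : n%:R != 0 :> rat by rewrite pnatr_eq0; case: n on {nc}.
have [c0|c0] := eqVneq c 0.
  rewrite /v2 c0 eqxx; split; first exact: leey.
  move: nc; rewrite c0 mulr0 => /esym/eqP; rewrite mulf_eq0 pnatr_eq0 expn_eq0 /= intr_eq0.
  by move/eqP ->.
have z0 : z != 0.
  apply: contra_neq c0 => z0; apply: (mulfI n0); rewrite mulr0 nc z0; exact: mulr0.
have num0 : (0 < `|numq c|)%N by rewrite absz_gt0 numq_eq0.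
have den0 : (0 < `|denq c|)%N by rewrite absz_gt0 denq_eq0.
have E : (n * `|numq c| = 2 ^ t * `|z| * `|denq c|)%N.
  have key : n%:R * (numq c)%:~R = (2 ^ t)%:R * z%:~R * (denq c)%:~R :> rat.
    by rewrite -nc -mulrA numqE.
  rewrite -[n in LHS]absz_nat -[(2 ^ t)%N]absz_nat -!abszM; congr absz.
  by apply: (@intr_inj rat); rewrite !rmorphM.
have := congr1 (logn 2) E.
have zp : (0 < `|z|)%N by rewrite absz_gt0.
rewrite !lognM ?muln_gt0 ?expn_gt0 ?zp ?den0 //; last by case: n on {nc n0 E}.
rewrite pfactorK // logn_coprime ?coprime2n // add0n => L.
rewrite /v2 (negPf c0); split; first by rewrite lee_fin L; lia.
move=> oz; congr (_%:E); rewrite L logn_coprime ?coprime2n //; lia.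
Qed.

(** From (k - 1) G_k = e_(k/2), e_2 = 3 G_4 and e_3 = 5 G_6; the quotient by 6 is the b that belongs
    to a. *)
Definition gcoef k a : rat :=
  (wpU k./2)`_a`_((k - 4 * a) %/ 6) * (3 ^ a * 5 ^ ((k - 4 * a) %/ 6))%:R / (k.-1)%:R.

Lemma gcoefE k a b : (4 * a + 6 * b = k)%N ->
  gcoef k a = (wpU k./2)`_a`_b * (3 ^ a * 5 ^ b)%:R / (k.-1)%:R.
Proof. by move=> <-; rewrite /gcoef addKn mulKn. Qed.

Lemma coef2_natM (F : nzRingType) n (p : {poly {poly F}}) a b :
  (n%:R * p)`_a`_b = n%:R * p`_a`_b.
Proof. by rewrite mulr_natl !coefMn mulr_natl. Qed.

Section Expansion.
Variables (R : realType) (k : nat).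
Hypotheses (k_even : ~~ odd k) (k4 : (4 <= k)%N).

Lemma half_kE : (k./2.*2 = k)%N.
Proof. by rewrite -[RHS]odd_double_half (negPf k_even). Qed.

(** The universal polynomials evaluated at e_2 and e_3 of the lattice satisfy [wp_rec] with the same
    first four values as [wpcoef], hence agree with it. *)
Lemma latticeG_expansion (z : R[i]) : 0 < complex.Im z -> latticeG k z =
  \sum_(a < k.+1) \sum_(b < k.+1 | (4 * a + 6 * b == k)%N)
     ratr (gcoef k a) * latticeG 4 z ^+ a * latticeG 6 z ^+ b.
Proof.
move=> z0; set e := wpcoef z.
have m2 : (2 <= k./2)%N by have := half_kE; lia.
have ev : evalQ (e 2%N) (e 3%N) \o wpU =1 e.
  apply: (wp_rec_unique (@C_char0 R) (evalQ_rec (e 2%N) (e 3%N) wpU_rec) (wpcoef_rec z0)).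
  case=> [|[|[|[|//]]]] _ /=; rewrite ?wpU0 ?wpU1 ?(rmorph0 (evalQ _ _)) //.
    by rewrite wpU2 evalQ_X.
  by rewrite wpU3 evalQ_Y.
have k1 : k.-1%:R != 0 :> R[i] by rewrite pnatr_eq0; lia.
apply: (mulfI k1).
have -> : k.-1%:R * latticeG k z = e k./2 by rewrite /e /wpcoef ltnNge m2 /= half_kE.
rewrite -ev /= (@evalQ_sum _ _ _ k); last first.
  move=> a b ab; apply: homog_wpU; apply/eqP; move: ab half_kE => /orP[]; lia.
rewrite mulr_sumr; apply: eq_bigr => a _; rewrite mulr_sumr [RHS]big_mkcond /=.
apply: eq_bigr => b _; case: eqP => [abk|abk]; last first.
  rewrite homog_wpU ?rmorph0 ?mul0r //; apply/eqP => ab; apply: abk; have := half_kE; lia.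
rewrite (gcoefE abk) natrM !natrX !rmorphM fmorphV !rmorphXn !rmorph_nat /=.
have -> : e 2%N = 3 * latticeG 4 z by [].
have -> : e 3%N = 5 * latticeG 6 z by [].
by rewrite !exprMn; field.
Qed.

Lemma gcoef_expansion : is_Gexpansion R k (gcoef k).
Proof.
move=> z z0; rewrite eisensteinG_lattice ?latticeG_expansion //; last by apply: leq_trans k4.
by rewrite !eisensteinG_lattice.
Qed.

Lemma wE a b : (4 * a + 6 * b = k)%N -> w R a k = gcoef k a.
Proof.
move=> abk; have h := @xgetPex _ (fun=> 0) [set c | is_Gexpansion R k c] (ex_intro _ _ gcoef_expansion).
rewrite /w; move: (xget _ _) h => c hc.
apply/eqP; rewrite -subr_eq0; apply/eqP.
apply: (@G_indep R k (fun a => c a - gcoef k a) _ b a abk) => t t1.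
have z0 := iaxis_gt0 t1.
have := hc _ z0; rewrite (gcoef_expansion z0) !eisensteinG_lattice // => /eqP.
rewrite eq_sym -subr_eq0 -sumrB => /eqP h; rewrite -[RHS]h; apply: eq_bigr => a' _.
by rewrite -sumrB; apply: eq_bigr => b' _; rewrite rmorphB /= !mulrBl.
Qed.

(** As 3, 5 and k - 1 are odd, t bounds every valuation from below. An odd coefficient of P exists
    since [red P != 0], and homogeneity places it at some 4 a + 6 b = k, where t is attained. *)
Lemma bigmin_valuation t n (P : {poly {poly int}}) : odd n ->
  n%:R * wpU k./2 = (2 ^ t)%:R * toQ P -> red P != 0 ->
  \big[Order.min/+oo%E]_(a < k.+1 | [exists b : 'I_k.+1, (4 * a + 6 * b == k)%N]) v2 (w R a k)
  = t%:Z%:E.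
Proof.
move=> on nP P0.
have coefE a b : (4 * a + 6 * b = k)%N -> (t%:Z%:E <= v2 (w R a k))%E /\
    (odd (absz P`_a`_b) -> v2 (w R a k) = t%:Z%:E).
  move=> abk; rewrite (wE abk) (gcoefE abk).
  have ok1 : odd (n * k.-1) by rewrite oddM on /=; case: (k) k4 k_even => // l _ /negbNE.
  have [|le eq] := @v2_eq ((wpU k./2)`_a`_b * (3 ^ a * 5 ^ b)%:R / (k.-1)%:R) (n * k.-1) t
      (P`_a`_b * (3 ^ a * 5 ^ b)%:Z) ok1.
    have := congr1 (fun p : {poly {poly rat}} => p`_a`_b) nP.
    rewrite !coef2_natM toQ_coef => E.
    rewrite intrM [RHS]mulrA -E natrM.
    rewrite -[((3 ^ a * 5 ^ b)%:Z)%:~R]/((3 ^ a * 5 ^ b)%:R).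
    by field; rewrite pnatr_eq0; lia.
  split=> // oP; apply: eq; rewrite abszM oddM oP /= oddM !oddX.
  by rewrite !orbT.
have [a [b [abk oP]]] : exists a b, (4 * a + 6 * b = k)%N /\ odd (absz P`_a`_b).
  apply: contrapT => h; move/eqP: P0; apply; apply: red_eq0 => a b.
  apply/negP => oP; apply: h; exists a, b; split=> //.
  have := congr1 (fun p : {poly {poly rat}} => p`_a`_b) nP.
  rewrite !coef2_natM toQ_coef => E.
  apply: contrapT => abk; move: E; rewrite homog_wpU; last first.
    by apply/eqP => ab; apply: abk; have := half_kE; lia.
  rewrite mulr0 => /esym/eqP; rewrite mulf_eq0 pnatr_eq0 expn_eq0 /= intr_eq0 => /eqP P0.
  by rewrite P0 in oP.
have ak : (a < k.+1)%N by lia.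
have bk : (b < k.+1)%N by lia.
have le1 : (\big[Order.min/+oo%E]_(a < k.+1 | [exists b : 'I_k.+1, (4 * a + 6 * b == k)%N])
    v2 (w R a k) <= t%:Z%:E)%E.
  rewrite -((coefE _ _ abk).2 oP).
  by apply: (bigmin_le_cond _ (j := Ordinal ak)); apply/existsP; exists (Ordinal bk); apply/eqP.
apply/le_anti; rewrite le1 /=; apply: le_bigmin => [|i /existsP[j /eqP ij]]; first exact: leey.
by have [] := coefE _ _ ij.
Qed.

End Expansion.

Theorem theorem1 (R : realType) (k : nat) (k_even : ~~ odd k)
    (k_ge4 : (4 <= k)%N) :
  \big[Order.min/+oo%E]_(a < k.+1 | [exists b : 'I_k.+1, (4 * a + 6 * b == k)%N])
     v2 (w R a k)
  = if `[< exists m : nat, k = (2 ^ m)%N >] then 0%:E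
    else ((binary_ones k)%:Z - 2)%:E.
Proof.
have kE := half_kE k_even.
have m0 : (0 < k./2)%N by lia.
case: (asboolP (exists m, k = (2 ^ m)%N)) => [[m km]|npow].
  have [j mE] : exists j, k./2 = (2 ^ j.+1)%N.
    case: m km => [|[|j]] km; [lia|lia|exists j].
    by rewrite km expnS mul2n doubleK.
  have [n [P [on nP Px]]] := (reduces_wpU k./2).2 _ mE.
  rewrite (bigmin_valuation R k_even k_ge4 (t := 0) on (P := P)) //; first by rewrite mul1r.
  by rewrite Px expf_neq0 // redA_neq0.
have [[j kj]|[i [i0 im oC]]] := two_power_or_odd_bin m0.
  by case: npow; exists j.+1; rewrite -kE kj expnS mul2n.
have [s2 [n [P [on nP Px]]]] := wpU_val_general i0 im oC.
(* k and k / 2 have the same digit sum, and [s2] makes the natural subtraction of 2 exact. *)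
rewrite (bigmin_valuation R k_even k_ge4 on nP Px) -[in RHS]kE binary_ones_double.
by congr (_%:E); lia.
Qed.
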